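(* Let $\mathcal T$ be a tricategory with a 3-trace $\mathrm{tr}$ with values in a bicategory $\mathcal B$, and let $(f_1,\dots,f_n)$ be a string of cyclically composable 1-morphisms in $\mathcal T$. Let $\mathsf E:\mathcal X\to\mathcal B$ be the 2-functor given by evaluating the bicategory $\mathcal X$ of formal traces of strings of length $n$ on $(f_1,\dots,f_n)$. If it exists, the 2-limit $\lim\mathsf E$ of the 3-traces of the $f_i$ under the admissible equivalences depends only on the cyclic set $\{f_i\}$, i.e. on the string $(f_1,\dots,f_n)$ up to cyclic permutation.
   Context: 3-traces. Let $\mathcal T$ be a tricategory (in the algebraic sense of Gurski), with composition $\Box$ of 1-morphisms, associator 2-morphisms $a_{f,g,h}:(f\Box g)\Box h\Rightarrow f\Box(g\Box h)$, unit 2-morphisms $l_f:1\Box f\Rightarrow f$, $r_f:f\Box1\Rightarrow f$, weak inverses $a^-,l^-,r^-$, and invertible constraint 3-morphisms $\pi$ (pentagon) and $\mu,\lambda,\rho$ (units versus associators); let $\mathcal B$ be a bicategory. A 3-trace on $\mathcal T$ with values in $\mathcal B$ consists of 2-functors (with invertible coherence 2-morphisms) $\mathrm{tr}_x:\mathcal T(x,x)\to\mathcal B$ for all objects $x$ and the following. (i) For all $x,y$ an adjoint equivalence $\varphi(x,y)$ between the 2-functors $\mathcal T(x,y)\times\mathcal T(y,x)\to\mathcal B$ given by $(f,g)\mapsto\mathrm{tr}_y(f\Box g)$ and $(f,g)\mapsto\mathrm{tr}_x(g\Box f)$; its components are adjoint equivalences $\varphi(f,g):\mathrm{tr}_y(f\Box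 g)\to\mathrm{tr}_x(g\Box f)$. (ii) For $f_1:x\to y$, $f_2:y\to z$, $f_3:z\to x$ an invertible modification $m(f_3,f_2,f_1)$ from the composite $\mathrm{tr}_x((f_3\Box f_2)\Box f_1)\xrightarrow{\varphi(f_3\Box f_2,f_1)}\mathrm{tr}_y(f_1\Box(f_3\Box f_2))\simeq\mathrm{tr}_y((f_1\Box f_3)\Box f_2)\xrightarrow{\varphi(f_1\Box f_3,f_2)}\mathrm{tr}_z(f_2\Box(f_1\Box f_3))\simeq\mathrm{tr}_z((f_2\Box f_1)\Box f_3)$ to the composite $\mathrm{tr}_x((f_3\Box f_2)\Box f_1)\simeq\mathrm{tr}_x(f_3\Box(f_2\Box f_1))\xrightarrow{\varphi(f_3,f_2\Box f_1)}\mathrm{tr}_z((f_2\Box f_1)\Box f_3)$, where $\simeq$ are traces of associators. (iii) An invertible modification $\kappa$ with components $\kappa_f:\mathrm{tr}(r_f)\circ\varphi(1,f)\circ\mathrm{tr}(l_f^-)\Rightarrow1_{\mathrm{tr}(f)}$ for $f:x\to x$. Axioms: (1) for cyclically composable $f_1,\dots,f_4$ (writing $43$ for $f_4\Box f_3$ etc. and suppressing associators), $m(4,3,21)\cdot(\mathrm{id}_{\varphi(214,3)}\circ m(43,2,1))=m(4,32,1)\cdot(m(14,3,2)\circ\mathrm{id}_{\varphi(432,1)})$ as 2-morphisms $\varphi(214,3)\circ\varphi(143,2)\circ\varphi(432,1)\Rightarrow\varphi(4,321)$. (2) For $f:x\to y$, $g:y\to x$, let $u_{f,g}:1_{\mathrm{tr}(f\Box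 g)}\Rightarrow\varphi(g,f)\circ\varphi(f,g)$ be the invertible 2-morphism obtained by composing $\kappa_{f\Box g}^{-1}$, then $m(1,f,g)^{-1}$ (giving $\varphi(g\Box1,f)\circ\varphi(1\Box f,g)$ up to associators and units), then the naturality of $\varphi$ with respect to the unit 2-morphisms and the unit constraint 3-morphism of $\mathcal T$; these 2-morphisms must exhibit $\varphi(f,g)$ and $\varphi(g,f)$ as an adjoint equivalence (snake identities). Cyclically composable: $f_n\Box\cdots\Box f_1$ is composable and the source of $f_1$ equals the target of $f_n$. Formal 2-graph $\mathcal G$ (for fixed $n$). Vertices: fully bracketed words in the binary operation $\Box$ with $n$ placeholders and any number of occurrences of a formal unit $I$, together with a cut point, which determines the cyclic rotation in which $f_1,\dots,f_n$ are inserted (for cut point $i$ the rightmost letter is $f_i$, followed to the left by $f_{i+1},\dots,f_n,f_1,\dots,f_{i-1}$). 1-cells: associators $a$, unit cells $l$, $r$ and their inverses (applied to subwords), and, for a word of the form $(b_1)\Box(b_2)$, the cell $\varphi((b_1),(b_2))$ to the vertex with word $(b_2)\Box(b_1)$ and correspondingly shifted cut point (by the number $|b_2|$ of letters of $b_2$). 2-cells between strings of 1-cells: those representing $\pi,\lambda,\rho,\mu$, those relating $a,l,r$ and their inverses to identities, those given by $m$ and $\kappa$, and all naturality 2-cells of the 1-cells (all with inverses). A vertex $v$ is evaluated on $(f_1,\dots,f_n)$ by inserting the $f_i$ (and unit 1-morphisms for $I$) and applying $\mathrm{tr}$; 1-cells and 2-cells are evaluated using the corresponding structure of $\mathcal T$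 and $\mathrm{tr}$. Bicategory $\mathcal X$. Objects: vertices of $\mathcal G$. 1-morphisms: composable strings of 1-cells. 2-morphisms: composable strings of 2-cells modulo the equivalences induced by the axioms of a tricategory and the two axioms of a 3-trace. Evaluation on $(f_1,\dots,f_n)$ is a 2-functor $\mathsf E:\mathcal X\to\mathcal B$; ''admissible equivalences'' are the 1-morphisms of $\mathcal B$ in its image. 2-limit. A 2-limit of $\mathsf E:\mathcal X\to\mathcal B$ is an object $\lim\mathsf E\in\mathcal B$ with equivalences of categories $\mathcal B(b,\lim\mathsf E)\simeq[\mathcal X,\mathcal B](\underline b,\mathsf E)$ for all $b\in\mathcal B$ (2-natural in $b$), where $[\mathcal X,\mathcal B]$ is the bicategory of 2-functors and $\underline b$ is the constant 2-functor. *)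

(* Defs.v *)
From mathcomp Require Import all_boot.
From Stdlib Require Import Setoid Morphisms.

Set Implicit Arguments.
Unset Strict Implicit.
Unset Printing Implicit Defensive.
Set Primitive Projections.

Declare Scope bicat_scope.
Delimit Scope bicat_scope with bicat.
Local Open Scope bicat_scope.

(** * Bicategories

   2-cells are compared by an equivalence relation [eq2] instead of Leibniz
   equality, so that 2-cells "modulo relations" need no quotient types.
   Every notion is split into operations ([...Data]) and axioms ([...Laws]):
   the axioms can then be imposed on purely formal operations, which is how
   the relations between formal 2-cells are generated below. *)

Record pprod (A B : Type) := PPair { pfst : A; psnd : B }.
Arguments PPair {A B} _ _.
Notation "⟨ a , b ⟩" := (PPair a b) (at level 0) : bicat_scope.

Record BicatData := MkBicat {
  ob :> Type;
  hom1 : ob -> ob -> Type;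
  hom2 : forall x y : ob, hom1 x y -> hom1 x y -> Type;
  eq2 : forall (x y : ob) (f g : hom1 x y), hom2 f g -> hom2 f g -> Prop;
  id1 : forall x : ob, hom1 x x;
  comp1 : forall x y z : ob, hom1 y z -> hom1 x y -> hom1 x z;
  id2 : forall (x y : ob) (f : hom1 x y), hom2 f f;
  vcomp : forall (x y : ob) (f g h : hom1 x y),
    hom2 g h -> hom2 f g -> hom2 f h;
  hcomp : forall (x y z : ob) (g g' : hom1 y z) (f f' : hom1 x y),
    hom2 g g' -> hom2 f f' -> hom2 (comp1 g f) (comp1 g' f');
  lun : forall (x y : ob) (f : hom1 x y), hom2 (comp1 (id1 y) f) f;
  lunV : forall (x y : ob) (f : hom1 x y), hom2 f (comp1 (id1 y) f);
  run : forall (x y : ob) (f : hom1 x y), hom2 (comp1 f (id1 x)) f;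
  runV : forall (x y : ob) (f : hom1 x y), hom2 f (comp1 f (id1 x));
  asc : forall (x y z w : ob) (h : hom1 z w) (g : hom1 y z) (f : hom1 x y),
    hom2 (comp1 (comp1 h g) f) (comp1 h (comp1 g f));
  ascV : forall (x y z w : ob) (h : hom1 z w) (g : hom1 y z) (f : hom1 x y),
    hom2 (comp1 h (comp1 g f)) (comp1 (comp1 h g) f)
}.
Arguments hom1 {b} _ _.
Arguments hom2 {b x y} _ _.
Arguments eq2 {b x y f g} _ _.
Arguments id1 {b} x.
Arguments comp1 {b x y z} _ _.
Arguments id2 {b x y} f.
Arguments vcomp {b x y f g h} _ _.
Arguments hcomp {b x y z g g' f f'} _ _.
Arguments lun {b x y} f.
Arguments lunV {b x y} f.
Arguments run {b x y} f.
Arguments runV {b x y} f.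
Arguments asc {b x y z w} h g f.
Arguments ascV {b x y z w} h g f.

Notation "g ∘ f" := (comp1 g f) (at level 40, left associativity) : bicat_scope.
Notation "β • α" := (vcomp β α) (at level 47, right associativity) : bicat_scope.
Notation "β ∗ α" := (hcomp β α) (at level 44, left associativity) : bicat_scope.
Notation "α ≈ β" := (eq2 α β) (at level 70) : bicat_scope.

Definition inverse2 (B : BicatData) (x y : B) (f g : hom1 x y)
    (α : hom2 f g) (β : hom2 g f) : Prop :=
  β • α ≈ id2 f /\ α • β ≈ id2 g.

Record BicatLaws (B : BicatData) : Prop := {
  eq2_equiv : forall (x y : B) (f g : hom1 x y), Equivalence (@eq2 B x y f g);
  vcomp_eq : forall (x y : B) (f g h : hom1 x y)
    (β β' : hom2 g h) (α α' : hom2 f g), β ≈ β' -> α ≈ α' -> β • α ≈ β' • α';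
  hcomp_eq : forall (x y z : B) (g g' : hom1 y z) (f f' : hom1 x y)
    (β β' : hom2 g g') (α α' : hom2 f f'), β ≈ β' -> α ≈ α' -> β ∗ α ≈ β' ∗ α';
  vcompA : forall (x y : B) (f g h k : hom1 x y)
    (γ : hom2 h k) (β : hom2 g h) (α : hom2 f g), (γ • β) • α ≈ γ • (β • α);
  vcomp1l : forall (x y : B) (f g : hom1 x y) (α : hom2 f g), id2 g • α ≈ α;
  vcomp1r : forall (x y : B) (f g : hom1 x y) (α : hom2 f g), α • id2 f ≈ α;
  hcomp_id : forall (x y z : B) (g : hom1 y z) (f : hom1 x y),
    id2 g ∗ id2 f ≈ id2 (g ∘ f);
  hcomp_vcomp : forall (x y z : B) (g g' g'' : hom1 y z) (f f' f'' : hom1 x y)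
    (β' : hom2 g' g'') (β : hom2 g g') (α' : hom2 f' f'') (α : hom2 f f'),
    (β' • β) ∗ (α' • α) ≈ (β' ∗ α') • (β ∗ α);
  lun_nat : forall (x y : B) (f f' : hom1 x y) (α : hom2 f f'),
    lun f' • (id2 (id1 y) ∗ α) ≈ α • lun f;
  run_nat : forall (x y : B) (f f' : hom1 x y) (α : hom2 f f'),
    run f' • (α ∗ id2 (id1 x)) ≈ α • run f;
  asc_nat : forall (x y z w : B) (h h' : hom1 z w) (g g' : hom1 y z)
    (f f' : hom1 x y) (γ : hom2 h h') (β : hom2 g g') (α : hom2 f f'),
    asc h' g' f' • ((γ ∗ β) ∗ α) ≈ (γ ∗ (β ∗ α)) • asc h g f;
  lun_inv : forall (x y : B) (f : hom1 x y), inverse2 (lun f) (lunV f);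
  run_inv : forall (x y : B) (f : hom1 x y), inverse2 (run f) (runV f);
  asc_inv : forall (x y z w : B) (h : hom1 z w) (g : hom1 y z) (f : hom1 x y),
    inverse2 (asc h g f) (ascV h g f);
  pentagon : forall (v w x y z : B) (k : hom1 y z) (h : hom1 x y)
    (g : hom1 w x) (f : hom1 v w),
    asc k h (g ∘ f) • asc (k ∘ h) g f
    ≈ (id2 k ∗ asc h g f) • asc k (h ∘ g) f • (asc k h g ∗ id2 f);
  triangle : forall (x y z : B) (g : hom1 y z) (f : hom1 x y),
    (id2 g ∗ lun f) • asc g (id1 y) f ≈ run g ∗ id2 f
}.

Record Bicat := { bicat_data :> BicatData; bicat_laws : BicatLaws bicat_data }.

Definition oneB : BicatData := {|
  ob := unit; hom1 := fun _ _ => unit; hom2 := fun _ _ _ _ => unit;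
  eq2 := fun _ _ _ _ _ _ => True;
  id1 := fun _ => tt; comp1 := fun _ _ _ _ _ => tt; id2 := fun _ _ _ => tt;
  vcomp := fun _ _ _ _ _ _ _ => tt; hcomp := fun _ _ _ _ _ _ _ _ _ => tt;
  lun := fun _ _ _ => tt; lunV := fun _ _ _ => tt;
  run := fun _ _ _ => tt; runV := fun _ _ _ => tt;
  asc := fun _ _ _ _ _ _ _ => tt; ascV := fun _ _ _ _ _ _ _ => tt |}.

Definition prodB (A B : BicatData) : BicatData := {|
  ob := pprod A B;
  hom1 := fun p q => pprod (hom1 (pfst p) (pfst q)) (hom1 (psnd p) (psnd q));
  hom2 := fun p q f g => pprod (hom2 (pfst f) (pfst g)) (hom2 (psnd f) (psnd g));
  eq2 := fun p q f g α β => pfst α ≈ pfst β /\ psnd α ≈ psnd β;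
  id1 := fun p => ⟨id1 (pfst p), id1 (psnd p)⟩;
  comp1 := fun p q r g f => ⟨pfst g ∘ pfst f, psnd g ∘ psnd f⟩;
  id2 := fun p q f => ⟨id2 (pfst f), id2 (psnd f)⟩;
  vcomp := fun p q f g h β α => ⟨pfst β • pfst α, psnd β • psnd α⟩;
  hcomp := fun p q r g g' f f' β α => ⟨pfst β ∗ pfst α, psnd β ∗ psnd α⟩;
  lun := fun p q f => ⟨lun (pfst f), lun (psnd f)⟩;
  lunV := fun p q f => ⟨lunV (pfst f), lunV (psnd f)⟩;
  run := fun p q f => ⟨run (pfst f), run (psnd f)⟩;
  runV := fun p q f => ⟨runV (pfst f), runV (psnd f)⟩;
  asc := fun p q r s h g f =>
    ⟨asc (pfst h) (pfst g) (pfst f), asc (psnd h) (psnd g) (psnd f)⟩;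
  ascV := fun p q r s h g f =>
    ⟨ascV (pfst h) (pfst g) (pfst f), ascV (psnd h) (psnd g) (psnd f)⟩ |}.

Record RMap (A B : BicatData) := MkRMap {
  r0 :> A -> B;
  r1 : forall x y : A, hom1 x y -> hom1 (r0 x) (r0 y)
}.
Arguments MkRMap {A B} r0 r1.
Arguments r0 {A B} _ _.
Arguments r1 {A B} _ {x y} _.

Record PFunData (A B : BicatData) := MkPFun {
  rmap :> RMap A B;
  map2 : forall (x y : A) (f g : hom1 x y),
    hom2 f g -> hom2 (r1 rmap f) (r1 rmap g);
  mcomp : forall (x y z : A) (g : hom1 y z) (f : hom1 x y),
    hom2 (r1 rmap g ∘ r1 rmap f) (r1 rmap (g ∘ f));
  mcompV : forall (x y z : A) (g : hom1 y z) (f : hom1 x y),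
    hom2 (r1 rmap (g ∘ f)) (r1 rmap g ∘ r1 rmap f);
  mid : forall x : A, hom2 (id1 (rmap x)) (r1 rmap (id1 x));
  midV : forall x : A, hom2 (r1 rmap (id1 x)) (id1 (rmap x))
}.
Arguments map2 {A B} _ {x y f g} _.
Arguments mcomp {A B} _ {x y z} g f.
Arguments mcompV {A B} _ {x y z} g f.
Arguments mid {A B} _ x.
Arguments midV {A B} _ x.

Record PFunLaws (A B : BicatData) (F : PFunData A B) : Prop := {
  map2_eq : forall (x y : A) (f g : hom1 x y) (α β : hom2 f g),
    α ≈ β -> map2 F α ≈ map2 F β;
  map2_id : forall (x y : A) (f : hom1 x y), map2 F (id2 f) ≈ id2 (r1 F f);
  map2_vcomp : forall (x y : A) (f g h : hom1 x y) (β : hom2 g h) (α : hom2 f g),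
    map2 F (β • α) ≈ map2 F β • map2 F α;
  mcomp_nat : forall (x y z : A) (g g' : hom1 y z) (f f' : hom1 x y)
    (β : hom2 g g') (α : hom2 f f'),
    mcomp F g' f' • (map2 F β ∗ map2 F α) ≈ map2 F (β ∗ α) • mcomp F g f;
  mcomp_inv : forall (x y z : A) (g : hom1 y z) (f : hom1 x y),
    inverse2 (mcomp F g f) (mcompV F g f);
  mid_inv : forall x : A, inverse2 (mid F x) (midV F x);
  mcomp_asc : forall (x y z w : A) (h : hom1 z w) (g : hom1 y z) (f : hom1 x y),
    map2 F (asc h g f) • mcomp F (h ∘ g) f • (mcomp F h g ∗ id2 (r1 F f))
    ≈ mcomp F h (g ∘ f) • (id2 (r1 F h) ∗ mcomp F g f)
        • asc (r1 F h) (r1 F g) (r1 F f);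
  mcomp_lun : forall (x y : A) (f : hom1 x y),
    map2 F (lun f) • mcomp F (id1 y) f • (mid F y ∗ id2 (r1 F f))
    ≈ lun (r1 F f);
  mcomp_run : forall (x y : A) (f : hom1 x y),
    map2 F (run f) • mcomp F f (id1 x) • (id2 (r1 F f) ∗ mid F x)
    ≈ run (r1 F f)
}.

Definition rcomp (A B C : BicatData) (G : RMap B C) (F : RMap A B) : RMap A C :=
  MkRMap (fun x => G (F x)) (fun x y f => r1 G (r1 F f)).

Definition rpair (A B C : BicatData) (F : RMap A B) (G : RMap A C) :
  RMap A (prodB B C) :=
  MkRMap (B := prodB B C) (fun x => ⟨F x, G x⟩) (fun x y f => ⟨r1 F f, r1 G f⟩).

Definition idF (A : BicatData) : PFunData A A := {|
  rmap := MkRMap (fun x => x) (fun x y f => f);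
  map2 := fun x y f g α => α;
  mcomp := fun x y z g f => id2 (g ∘ f);
  mcompV := fun x y z g f => id2 (g ∘ f);
  mid := fun x => id2 (id1 x);
  midV := fun x => id2 (id1 x) |}.

Definition compF (A B C : BicatData) (G : PFunData B C) (F : PFunData A B) :
  PFunData A C := {|
  rmap := rcomp G F;
  map2 := fun x y f g α => map2 G (map2 F α);
  mcomp := fun x y z g f => map2 G (mcomp F g f) • mcomp G (r1 F g) (r1 F f);
  mcompV := fun x y z g f => mcompV G (r1 F g) (r1 F f) • map2 G (mcompV F g f);
  mid := fun x => map2 G (mid F x) • mid G (F x);
  midV := fun x => midV G (F x) • map2 G (midV F x) |}.

Definition pairF (A B C : BicatData) (F : PFunData A B) (G : PFunData A C) :
  PFunData A (prodB B C) := {|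
  rmap := rpair F G;
  map2 := fun x y f g α => ⟨map2 F α, map2 G α⟩;
  mcomp := fun x y z g f => ⟨mcomp F g f, mcomp G g f⟩;
  mcompV := fun x y z g f => ⟨mcompV F g f, mcompV G g f⟩;
  mid := fun x => ⟨mid F x, mid G x⟩;
  midV := fun x => ⟨midV F x, midV G x⟩ |}.

Definition fstF (A B : BicatData) : PFunData (prodB A B) A := {|
  rmap := MkRMap (A := prodB A B) (fun x => pfst x) (fun x y f => pfst f);
  map2 := fun x y f g α => pfst α;
  mcomp := fun x y z g f => id2 (pfst g ∘ pfst f);
  mcompV := fun x y z g f => id2 (pfst g ∘ pfst f);
  mid := fun x => id2 (id1 (pfst x));
  midV := fun x => id2 (id1 (pfst x)) |}.

Definition sndF (A B : BicatData) : PFunData (prodB A B) B := {|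
  rmap := MkRMap (A := prodB A B) (fun x => psnd x) (fun x y f => psnd f);
  map2 := fun x y f g α => psnd α;
  mcomp := fun x y z g f => id2 (psnd g ∘ psnd f);
  mcompV := fun x y z g f => id2 (psnd g ∘ psnd f);
  mid := fun x => id2 (id1 (psnd x));
  midV := fun x => id2 (id1 (psnd x)) |}.

Definition constF (A B : BicatData) (b : B) : PFunData A B := {|
  rmap := MkRMap (fun _ => b) (fun _ _ _ => id1 b);
  map2 := fun _ _ _ _ _ => id2 (id1 b);
  mcomp := fun _ _ _ _ _ => lun (id1 b);
  mcompV := fun _ _ _ _ _ => lunV (id1 b);
  mid := fun _ => id2 (id1 b);
  midV := fun _ => id2 (id1 b) |}.

Arguments idF {A}.
Arguments fstF {A B}.
Arguments sndF {A B}.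
Arguments constF A {B} b.

Record TransData (A B : BicatData) (F G : RMap A B) := MkTrans {
  tc :> forall x : A, hom1 (F x) (G x);
  tn : forall (x y : A) (f : hom1 x y), hom2 (r1 G f ∘ tc x) (tc y ∘ r1 F f);
  tnV : forall (x y : A) (f : hom1 x y), hom2 (tc y ∘ r1 F f) (r1 G f ∘ tc x)
}.
Arguments MkTrans {A B F G} & tc tn tnV.
Arguments tc {A B F G} _ x.
Arguments tn {A B F G} _ {x y} f.
Arguments tnV {A B F G} _ {x y} f.

Record TransLaws (A B : BicatData) (F G : PFunData A B) (σ : TransData F G) :
  Prop := {
  tn_nat : forall (x y : A) (f f' : hom1 x y) (α : hom2 f f'),
    tn σ f' • (map2 G α ∗ id2 (σ x)) ≈ (id2 (σ y) ∗ map2 F α) • tn σ f;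
  tn_inv : forall (x y : A) (f : hom1 x y), inverse2 (tn σ f) (tnV σ f);
  tn_comp : forall (x y z : A) (g : hom1 y z) (f : hom1 x y),
    tn σ (g ∘ f) • (mcomp G g f ∗ id2 (σ x))
    ≈ (id2 (σ z) ∗ mcomp F g f) • asc (σ z) (r1 F g) (r1 F f)
        • (tn σ g ∗ id2 (r1 F f)) • ascV (r1 G g) (σ y) (r1 F f)
        • (id2 (r1 G g) ∗ tn σ f) • asc (r1 G g) (r1 G f) (σ x);
  tn_id : forall x : A,
    tn σ (id1 x) • (mid G x ∗ id2 (σ x))
    ≈ (id2 (σ x) ∗ mid F x) • runV (σ x) • lun (σ x)
}.

Definition tid (A B : BicatData) (F : RMap A B) : TransData F F :=
  MkTrans (fun x => id1 (F x))
    (fun x y f => lunV (r1 F f) • run (r1 F f))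
    (fun x y f => runV (r1 F f) • lun (r1 F f)).

(** In diagrammatic order: first [σ], then [τ]. *)
Definition tcomp (A B : BicatData) (F G H : RMap A B)
    (σ : TransData F G) (τ : TransData G H) : TransData F H :=
  MkTrans (fun x => τ x ∘ σ x)
    (fun x y f => ascV (τ y) (σ y) (r1 F f) • (id2 (τ y) ∗ tn σ f)
       • asc (τ y) (r1 G f) (σ x) • (tn τ f ∗ id2 (σ x))
       • ascV (r1 H f) (τ x) (σ x))
    (fun x y f => asc (r1 H f) (τ x) (σ x) • (tnV τ f ∗ id2 (σ x))
       • ascV (τ y) (r1 G f) (σ x) • (id2 (τ y) ∗ tnV σ f)
       • asc (τ y) (σ y) (r1 F f)).
Notation "σ ⨾ τ" := (tcomp σ τ) (at level 41, right associativity) : bicat_scope.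

(** Whiskering of a transformation with a map before, and a 2-functor after. *)
Definition tpre (A B C : BicatData) (F G : RMap B C) (σ : TransData F G)
    (K : RMap A B) : TransData (rcomp F K) (rcomp G K) :=
  MkTrans (F := rcomp F K) (G := rcomp G K) (fun x => σ (K x))
    (fun x y f => tn σ (r1 K f)) (fun x y f => tnV σ (r1 K f)).

Definition tpost (A B C : BicatData) (F G : RMap A B) (K : PFunData B C)
    (σ : TransData F G) : TransData (rcomp K F) (rcomp K G) :=
  MkTrans (F := rcomp K F) (G := rcomp K G) (fun x => r1 K (σ x))
    (fun x y f => mcompV K (σ y) (r1 F f) • map2 K (tn σ f)
       • mcomp K (r1 G f) (σ x))
    (fun x y f => mcompV K (r1 G f) (σ x) • map2 K (tnV σ f)
       • mcomp K (σ y) (r1 F f)).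

Definition tpair (A B C : BicatData) (F G : RMap A B) (F' G' : RMap A C)
    (σ : TransData F G) (τ : TransData F' G') :
  TransData (rpair F F') (rpair G G') :=
  MkTrans (F := rpair F F') (G := rpair G G') (fun x => ⟨σ x, τ x⟩)
    (fun x y f => ⟨tn σ f, tn τ f⟩) (fun x y f => ⟨tnV σ f, tnV τ f⟩).

Definition is_modification (A B : BicatData) (F G : RMap A B)
    (σ τ : TransData F G) (Γ : forall x : A, hom2 (σ x) (τ x)) : Prop :=
  forall (x y : A) (f : hom1 x y),
    tn τ f • (id2 (r1 G f) ∗ Γ x) ≈ (Γ y ∗ id2 (r1 F f)) • tn σ f.

(** Invertible modifications. *)
Record ModData (A B : BicatData) (F G : RMap A B) (σ τ : TransData F G) :=
  MkMod {
  mc : forall x : A, hom2 (σ x) (τ x);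
  mcV : forall x : A, hom2 (τ x) (σ x)
}.
Arguments MkMod {A B F G σ τ} & mc mcV.
Arguments mc {A B F G σ τ} _ x.
Arguments mcV {A B F G σ τ} _ x.

Record ModLaws (A B : BicatData) (F G : RMap A B) (σ τ : TransData F G)
    (Γ : ModData σ τ) : Prop := {
  mc_mod : is_modification (mc Γ);
  mc_inv : forall x : A, inverse2 (mc Γ x) (mcV Γ x)
}.

(** The data and axioms that complete a transformation to an adjoint
   equivalence in the bicategory of 2-functors [A -> B]. *)
Record AdjEqData (A B : BicatData) (F G : RMap A B) (σ : TransData F G) :=
  MkAdjEq {
  adjV : TransData G F;
  aunit : ModData (tid F) (σ ⨾ adjV);
  acounit : ModData (adjV ⨾ σ) (tid G)
}.
Arguments MkAdjEq {A B F G σ} & adjV aunit acounit.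
Arguments adjV {A B F G σ} _.
Arguments aunit {A B F G σ} _.
Arguments acounit {A B F G σ} _.

Record AdjEqLaws (A B : BicatData) (F G : PFunData A B) (σ : TransData F G)
    (E : AdjEqData σ) : Prop := {
  adj_trans : TransLaws σ;
  adjV_trans : @TransLaws A B G F (adjV E);
  aunit_mod : ModLaws (aunit E);
  acounit_mod : ModLaws (acounit E);
  adj_snake : forall x : A, let f := σ x in let g := adjV E x in
    lun f • (mc (acounit E) x ∗ id2 f) • ascV f g f
      • (id2 f ∗ mc (aunit E) x) • runV f ≈ id2 f;
  adjV_snake : forall x : A, let f := σ x in let g := adjV E x in
    run g • (id2 g ∗ mc (acounit E) x) • asc g f g
      • (mc (aunit E) x ∗ id2 g) • lunV g ≈ id2 g
}.

(** * Strings of 1-cells and pasting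

   A string of 1-cells (listed in the order in which they are applied) is
   evaluated by bracketing: [f; g; h] becomes (h ∘ g) ∘ f.  The associators and
   unit constraints of the bicategory are absorbed in the operations on
   [ccell], the 2-cells between strings, so pasting diagrams can be written as
   in a strict 2-category. *)

Inductive chain (V : Type) (E : V -> V -> Type) : V -> V -> Type :=
| cnil x : chain E x x
| ccons x y z : E x y -> chain E y z -> chain E x z.
Arguments cnil {V E} x.
Arguments ccons {V E x y z} _ _.

Notation "[< >]" := (cnil _) (format "[< >]") : bicat_scope.
Notation "[< f ; .. ; g >]" := (ccons f .. (ccons g (cnil _)) ..)
  (format "[< f ;  .. ;  g >]") : bicat_scope.

Fixpoint capp (V : Type) (E : V -> V -> Type) (x y z : V) (p : chain E x y) :
  chain E y z -> chain E x z :=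
  match p in chain _ x y return chain E y z -> chain E x z with
  | cnil _ => fun q => q
  | ccons _ _ _ f p' => fun q => ccons f (capp p' q)
  end.

Fixpoint cmap (V W : Type) (E : V -> V -> Type) (D : W -> W -> Type)
    (i : V -> W) (φ : forall x y, E x y -> D (i x) (i y)) (x y : V)
    (p : chain E x y) : chain D (i x) (i y) :=
  match p in chain _ x y return chain D (i x) (i y) with
  | cnil x => cnil (i x)
  | ccons x y z f p' => ccons (φ x y f) (cmap φ p')
  end.

Section Strings.
Context {B : BicatData}.
Notation bchain := (chain (@hom1 B)).

Fixpoint cevc (x y z : B) (f : hom1 x y) (p : bchain y z) : hom1 x z :=
  match p in chain _ y z return hom1 x y -> hom1 x z with
  | cnil _ => fun f => f
  | ccons _ _ _ g p' => fun f => cevc g p' ∘ f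
  end f.

Definition cev (x y : B) (p : bchain x y) : hom1 x y :=
  match p with
  | cnil x => id1 x
  | ccons _ _ _ f p' => cevc f p'
  end.

(** Comparison of [cev (ccons f p)] with [cev p ∘ f]. *)
Definition cev_cons (x y z : B) (f : hom1 x y) (p : bchain y z) :
  hom2 (cevc f p) (cev p ∘ f) :=
  match p as p in chain _ y z
    return forall f : hom1 x y, hom2 (cevc f p) (cev p ∘ f) with
  | cnil _ => fun f => lunV f
  | ccons _ _ _ g p' => fun f => id2 (cevc g p' ∘ f)
  end f.

Definition cev_consV (x y z : B) (f : hom1 x y) (p : bchain y z) :
  hom2 (cev p ∘ f) (cevc f p) :=
  match p as p in chain _ y z
    return forall f : hom1 x y, hom2 (cev p ∘ f) (cevc f p) with
  | cnil _ => fun f => lun f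
  | ccons _ _ _ g p' => fun f => id2 (cevc g p' ∘ f)
  end f.

Fixpoint cev_app (x y z : B) (p : bchain x y) :
  forall q : bchain y z, hom2 (cev (capp p q)) (cev q ∘ cev p) :=
  match p as p in chain _ x y
    return forall q : bchain y z, hom2 (cev (capp p q)) (cev q ∘ cev p) with
  | cnil _ => fun q => runV (cev q)
  | ccons _ _ _ f p' => fun q =>
      (id2 (cev q) ∗ cev_consV f p') • asc (cev q) (cev p') f
        • (cev_app p' q ∗ id2 f) • cev_cons f (capp p' q)
  end.

Fixpoint cev_appV (x y z : B) (p : bchain x y) :
  forall q : bchain y z, hom2 (cev q ∘ cev p) (cev (capp p q)) :=
  match p as p in chain _ x y
    return forall q : bchain y z, hom2 (cev q ∘ cev p) (cev (capp p q)) with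
  | cnil _ => fun q => run (cev q)
  | ccons _ _ _ f p' => fun q =>
      cev_consV f (capp p' q) • (cev_appV p' q ∗ id2 f)
        • ascV (cev q) (cev p') f • (id2 (cev q) ∗ cev_cons f p')
  end.

Definition ccell (x y : B) (p q : bchain x y) : Type := hom2 (cev p) (cev q).

Definition cvcomp (x y : B) (p q r : bchain x y)
    (α : ccell p q) (β : ccell q r) : ccell p r := vcomp β α.

Definition whisker (x y z w : B) (l : bchain x y) (p q : bchain y z)
    (α : ccell p q) (r : bchain z w) :
  ccell (capp l (capp p r)) (capp l (capp q r)) :=
  cev_appV l (capp q r)
    • ((cev_appV q r • (id2 (cev r) ∗ α) • cev_app p r) ∗ id2 (cev l))
    • cev_app l (capp p r).

End Strings.
Arguments ccell {B x y} p q.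
Arguments cvcomp {B x y p q r} α β.
Arguments whisker {B x y z w} l {p q} α r.

(** [α ⋄ β]: first [α], then [β];  [l ◃ α ▹ r]: [α] applied to the middle part
   of a string. *)
Notation "α ⋄ β" := (cvcomp α β)
  (at level 61, left associativity) : bicat_scope.
Notation "l ◃ α ▹ r" := (whisker l α r)
  (at level 50, α at next level, r at next level, no associativity) : bicat_scope.

Section MapStrings.
Context {A B : BicatData} (K : PFunData A B).

Definition cmapF (x y : A) (p : chain (@hom1 A) x y) :
  chain (@hom1 B) (K x) (K y) :=
  cmap (i := K) (fun _ _ f => r1 K f) p.

Fixpoint cmap_cevc (x y z : A) (f : hom1 x y) (p : chain (@hom1 A) y z) :
  hom2 (r1 K (cevc f p)) (cevc (r1 K f) (cmapF p)) :=
  match p as p in chain _ y z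
    return forall f : hom1 x y,
      hom2 (r1 K (cevc f p)) (cevc (r1 K f) (cmapF p)) with
  | cnil _ => fun f => id2 (r1 K f)
  | ccons _ _ _ g p' => fun f =>
      (cmap_cevc g p' ∗ id2 (r1 K f)) • mcompV K (cevc g p') f
  end f.

Fixpoint cmap_cevcV (x y z : A) (f : hom1 x y) (p : chain (@hom1 A) y z) :
  hom2 (cevc (r1 K f) (cmapF p)) (r1 K (cevc f p)) :=
  match p as p in chain _ y z
    return forall f : hom1 x y,
      hom2 (cevc (r1 K f) (cmapF p)) (r1 K (cevc f p)) with
  | cnil _ => fun f => id2 (r1 K f)
  | ccons _ _ _ g p' => fun f =>
      mcomp K (cevc g p') f • (cmap_cevcV g p' ∗ id2 (r1 K f))
  end f.

Definition cmap_cev (x y : A) (p : chain (@hom1 A) x y) :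
  hom2 (r1 K (cev p)) (cev (cmapF p)) :=
  match p as p in chain _ x y return hom2 (r1 K (cev p)) (cev (cmapF p)) with
  | cnil x => midV K x
  | ccons _ _ _ f p' => cmap_cevc f p'
  end.

Definition cmap_cevV (x y : A) (p : chain (@hom1 A) x y) :
  hom2 (cev (cmapF p)) (r1 K (cev p)) :=
  match p as p in chain _ x y return hom2 (cev (cmapF p)) (r1 K (cev p)) with
  | cnil x => mid K x
  | ccons _ _ _ f p' => cmap_cevcV f p'
  end.

Definition mapcell (x y : A) (p q : chain (@hom1 A) x y) (α : ccell p q) :
  ccell (cmapF p) (cmapF q) :=
  cmap_cev q • map2 K α • cmap_cevV p.

End MapStrings.
Arguments mapcell {A B} K {x y p q} α.

(** * Tricategories (algebraic, in the sense of Gurski)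

   Transformations between composite 2-functors are written in a context [Q]:
   1-morphisms of the tricategory depending on variables are 2-functors
   [Q -> Hom x y], and structure transformations are instantiated at them. *)

Record TriBase := MkTriBase {
  tob :> Type;
  Hom : tob -> tob -> BicatData;
  bx : forall x y z : tob, PFunData (prodB (Hom y z) (Hom x y)) (Hom x z);
  un : forall x : tob, PFunData oneB (Hom x x)
}.
Arguments Hom {t} x y.
Arguments bx {t x y z}.
Arguments un {t} x.

Definition boxF (T : TriBase) (Q : BicatData) (x y z : T)
    (F : PFunData Q (Hom y z)) (G : PFunData Q (Hom x y)) :
  PFunData Q (Hom x z) := compF bx (pairF F G).
Notation "F ⊡ G" := (boxF F G) (at level 39, left associativity) : bicat_scope.

Definition unitF (T : TriBase) (Q : BicatData) (x : T) : PFunData Q (Hom x x) :=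
  compF (un x) (constF Q (tt : oneB)).
Arguments unitF {T Q x}.

Definition box0 (T : TriBase) (x y z : T) (f : Hom y z) (g : Hom x y) : Hom x z :=
  bx (⟨f, g⟩ : prodB (Hom y z) (Hom x y)).
Notation "f □ g" := (box0 f g) (at level 39, left associativity) : bicat_scope.

Definition box1 (T : TriBase) (x y z : T) (f f' : Hom y z) (g g' : Hom x y)
    (s : hom1 f f') (t : hom1 g g') : hom1 (f □ g) (f' □ g') :=
  r1 bx (⟨s, t⟩ : @hom1 (prodB (Hom y z) (Hom x y)) ⟨f, g⟩ ⟨f', g'⟩).
Notation "s ⊠ t" := (box1 s t) (at level 39, left associativity) : bicat_scope.

Definition box2 (T : TriBase) (x y z : T) (f f' : Hom y z) (g g' : Hom x y)
    (s s' : hom1 f f') (t t' : hom1 g g') (α : hom2 s s') (β : hom2 t t') :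
  hom2 (s ⊠ t) (s' ⊠ t') :=
  @map2 (prodB (Hom y z) (Hom x y)) _ bx ⟨f, g⟩ ⟨f', g'⟩ ⟨s, t⟩ ⟨s', t'⟩ ⟨α, β⟩.

Definition one (T : TriBase) (x : T) : Hom x x := un x tt.

Definition boxl (T : TriBase) (x y z : T) (k : Hom y z) :
  PFunData (Hom x y) (Hom x z) := constF _ k ⊡ idF.
Definition boxr (T : TriBase) (x y z : T) (f : Hom x y) :
  PFunData (Hom y z) (Hom x z) := idF ⊡ constF _ f.
Arguments boxl {T x y z} k.
Arguments boxr {T x y z} f.

Definition boxT (T : TriBase) (Q : BicatData) (x y z : T)
    (F F' : PFunData Q (Hom y z)) (G G' : PFunData Q (Hom x y))
    (σ : TransData F F') (τ : TransData G G') : TransData (F ⊡ G) (F' ⊡ G') :=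
  tpost bx (tpair σ τ).

Section Projections3.
Context {A B C : BicatData}.
Definition v31 : PFunData (prodB A (prodB B C)) A := fstF.
Definition v32 : PFunData (prodB A (prodB B C)) B := compF fstF sndF.
Definition v33 : PFunData (prodB A (prodB B C)) C := compF sndF sndF.
End Projections3.
Section Projections4.
Context {A B C D : BicatData}.
Definition v41 : PFunData (prodB A (prodB B (prodB C D))) A := fstF.
Definition v42 : PFunData (prodB A (prodB B (prodB C D))) B := compF v31 sndF.
Definition v43 : PFunData (prodB A (prodB B (prodB C D))) C := compF v32 sndF.
Definition v44 : PFunData (prodB A (prodB B (prodB C D))) D := compF v33 sndF.
End Projections4.

Record TriAssocUnit (T : TriBase) := MkTriAssocUnit {
  ta : forall x y z w : T,
    TransData (A := prodB (Hom z w) (prodB (Hom y z) (Hom x y)))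
      (v31 ⊡ v32 ⊡ v33) (v31 ⊡ (v32 ⊡ v33));
  ta_adj : forall x y z w : T, AdjEqData (ta x y z w);
  tlu : forall x y : T, TransData (A := Hom x y) (unitF ⊡ idF) idF;
  tlu_adj : forall x y : T, AdjEqData (tlu x y);
  tru : forall x y : T, TransData (A := Hom x y) (idF ⊡ unitF) idF;
  tru_adj : forall x y : T, AdjEqData (tru x y)
}.
Arguments ta {T} _ {x y z w}.
Arguments ta_adj {T} _ {x y z w}.
Arguments tlu {T} _ {x y}.
Arguments tlu_adj {T} _ {x y}.
Arguments tru {T} _ {x y}.
Arguments tru_adj {T} _ {x y}.

Section AssocUnitInContext.
Context {T : TriBase} (S : TriAssocUnit T) {Q : BicatData}.

Definition aT (x y z w : T) (H : PFunData Q (Hom z w)) (G : PFunData Q (Hom y z))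
    (F : PFunData Q (Hom x y)) : TransData (H ⊡ G ⊡ F) (H ⊡ (G ⊡ F)) :=
  tpre (ta S) (pairF H (pairF G F)).
Definition aVT (x y z w : T) (H : PFunData Q (Hom z w)) (G : PFunData Q (Hom y z))
    (F : PFunData Q (Hom x y)) : TransData (H ⊡ (G ⊡ F)) (H ⊡ G ⊡ F) :=
  tpre (adjV (ta_adj S)) (pairF H (pairF G F)).
Definition lT (x y : T) (F : PFunData Q (Hom x y)) : TransData (unitF ⊡ F) F :=
  tpre (tlu S) F.
Definition lVT (x y : T) (F : PFunData Q (Hom x y)) : TransData F (unitF ⊡ F) :=
  tpre (adjV (tlu_adj S)) F.
Definition rT (x y : T) (F : PFunData Q (Hom x y)) : TransData (F ⊡ unitF) F :=
  tpre (tru S) F.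
Definition rVT (x y : T) (F : PFunData Q (Hom x y)) : TransData F (F ⊡ unitF) :=
  tpre (adjV (tru_adj S)) F.

Definition pi_src (v w x y z : T) (K : PFunData Q (Hom y z))
    (H : PFunData Q (Hom x y)) (G : PFunData Q (Hom w x))
    (F : PFunData Q (Hom v w)) :
  TransData (K ⊡ H ⊡ G ⊡ F) (K ⊡ (H ⊡ (G ⊡ F))) :=
  boxT (aT K H G) (tid F) ⨾ aT K (H ⊡ G) F ⨾ boxT (tid K) (aT H G F).
Definition pi_tgt (v w x y z : T) (K : PFunData Q (Hom y z))
    (H : PFunData Q (Hom x y)) (G : PFunData Q (Hom w x))
    (F : PFunData Q (Hom v w)) :
  TransData (K ⊡ H ⊡ G ⊡ F) (K ⊡ (H ⊡ (G ⊡ F))) :=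
  aT (K ⊡ H) G F ⨾ aT K H (G ⊡ F).
Definition mu_src (x y z : T) (G : PFunData Q (Hom y z))
    (F : PFunData Q (Hom x y)) : TransData (G ⊡ F) (G ⊡ F) :=
  boxT (rVT G) (tid F) ⨾ aT G unitF F ⨾ boxT (tid G) (lT F).
Definition lam_src (x y z : T) (G : PFunData Q (Hom y z))
    (F : PFunData Q (Hom x y)) : TransData (unitF ⊡ G ⊡ F) (G ⊡ F) :=
  boxT (lT G) (tid F).
Definition lam_tgt (x y z : T) (G : PFunData Q (Hom y z))
    (F : PFunData Q (Hom x y)) : TransData (unitF ⊡ G ⊡ F) (G ⊡ F) :=
  aT unitF G F ⨾ lT (G ⊡ F).
Definition rho_src (x y z : T) (G : PFunData Q (Hom y z))
    (F : PFunData Q (Hom x y)) : TransData (G ⊡ F) (G ⊡ (F ⊡ unitF)) :=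
  boxT (tid G) (rVT F).
Definition rho_tgt (x y z : T) (G : PFunData Q (Hom y z))
    (F : PFunData Q (Hom x y)) : TransData (G ⊡ F) (G ⊡ (F ⊡ unitF)) :=
  rVT (G ⊡ F) ⨾ aT G F unitF.
End AssocUnitInContext.

Record TriData := MkTri {
  tri_base :> TriBase;
  tri_au : TriAssocUnit tri_base;
  tri_pi : forall v w x y z : tri_base, ModData
    (A := prodB (Hom y z) (prodB (Hom x y) (prodB (Hom w x) (Hom v w))))
    (pi_src tri_au v41 v42 v43 v44) (pi_tgt tri_au v41 v42 v43 v44);
  tri_mu : forall x y z : tri_base, ModData (A := prodB (Hom y z) (Hom x y))
    (mu_src tri_au fstF sndF) (tid (fstF ⊡ sndF));
  tri_lam : forall x y z : tri_base, ModData (A := prodB (Hom y z) (Hom x y))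
    (lam_src tri_au fstF sndF) (lam_tgt tri_au fstF sndF);
  tri_rho : forall x y z : tri_base, ModData (A := prodB (Hom y z) (Hom x y))
    (rho_src tri_au fstF sndF) (rho_tgt tri_au fstF sndF)
}.
Arguments tri_pi {_ v w x y z}.
Arguments tri_mu {_ x y z}.
Arguments tri_lam {_ x y z}.
Arguments tri_rho {_ x y z}.

Section Components.
Context {T : TriData}.

Section Assoc.
Context {x y z w : T}.
Notation Q := (prodB (Hom z w) (prodB (Hom y z) (Hom x y))).
Definition a_ (h : Hom z w) (g : Hom y z) (f : Hom x y) :
  hom1 (h □ g □ f) (h □ (g □ f)) := tc (ta (tri_au T)) (⟨h, ⟨g, f⟩⟩ : Q).
Definition aV_ (h : Hom z w) (g : Hom y z) (f : Hom x y) :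
  hom1 (h □ (g □ f)) (h □ g □ f) :=
  tc (adjV (ta_adj (tri_au T))) (⟨h, ⟨g, f⟩⟩ : Q).

Context {h h' : Hom z w} {g g' : Hom y z} {f f' : Hom x y}.
Definition a_nat (u : hom1 h h') (t : hom1 g g') (s : hom1 f f') :
  ccell [< a_ h g f; u ⊠ (t ⊠ s) >] [< u ⊠ t ⊠ s; a_ h' g' f' >] :=
  tn (ta (tri_au T)) (⟨u, ⟨t, s⟩⟩ : @hom1 Q ⟨h, ⟨g, f⟩⟩ ⟨h', ⟨g', f'⟩⟩).
Definition a_natV (u : hom1 h h') (t : hom1 g g') (s : hom1 f f') :
  ccell [< u ⊠ t ⊠ s; a_ h' g' f' >] [< a_ h g f; u ⊠ (t ⊠ s) >] :=
  tnV (ta (tri_au T)) (⟨u, ⟨t, s⟩⟩ : @hom1 Q ⟨h, ⟨g, f⟩⟩ ⟨h', ⟨g', f'⟩⟩).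
End Assoc.

Section AssocCancel.
Context {x y z w : T} (h : Hom z w) (g : Hom y z) (f : Hom x y).
Notation q := (⟨h, ⟨g, f⟩⟩ : prodB (Hom z w) (prodB (Hom y z) (Hom x y))).
Definition aaV : ccell [< a_ h g f; aV_ h g f >] [< >] :=
  mcV (aunit (ta_adj (tri_au T))) q.
Definition aVa : ccell [< aV_ h g f; a_ h g f >] [< >] :=
  mc (acounit (ta_adj (tri_au T))) q.
Definition aVa_i : ccell [< >] [< aV_ h g f; a_ h g f >] :=
  mcV (acounit (ta_adj (tri_au T))) q.
End AssocCancel.

Section Units.
Context {x y : T} (f : Hom x y).
Definition l_ : hom1 (one y □ f) f := tc (tlu (tri_au T)) f.
Definition lV_ : hom1 f (one y □ f) := tc (adjV (tlu_adj (tri_au T))) f.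
Definition r_ : hom1 (f □ one x) f := tc (tru (tri_au T)) f.
Definition rV_ : hom1 f (f □ one x) := tc (adjV (tru_adj (tri_au T))) f.
Definition llV : ccell [< l_; lV_ >] [< >] := mcV (aunit (tlu_adj (tri_au T))) f.
Definition lVl_i : ccell [< >] [< lV_; l_ >] :=
  mcV (acounit (tlu_adj (tri_au T))) f.
Definition rrV_i : ccell [< >] [< r_; rV_ >] := mc (aunit (tru_adj (tri_au T))) f.
Definition rVr : ccell [< rV_; r_ >] [< >] := mc (acounit (tru_adj (tri_au T))) f.
End Units.

Section Constraints.
Context {v w x y z : T} (k : Hom y z) (h : Hom x y) (g : Hom w x) (f : Hom v w).
Notation q4 := (⟨k, ⟨h, ⟨g, f⟩⟩⟩ :
  prodB (Hom y z) (prodB (Hom x y) (prodB (Hom w x) (Hom v w)))).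
Notation q2 := (⟨g, f⟩ : prodB (Hom w x) (Hom v w)).

Definition pi_ : ccell
    [< a_ k h g ⊠ id1 f; a_ k (h □ g) f; id1 k ⊠ a_ h g f >]
    [< a_ (k □ h) g f; a_ k h (g □ f) >] := mc tri_pi q4.
Definition piV_ : ccell
    [< a_ (k □ h) g f; a_ k h (g □ f) >]
    [< a_ k h g ⊠ id1 f; a_ k (h □ g) f; id1 k ⊠ a_ h g f >] := mcV tri_pi q4.
Definition mu_ :
  ccell [< rV_ g ⊠ id1 f; a_ g (one w) f; id1 g ⊠ l_ f >] [< >] := mc tri_mu q2.
Definition muV_ :
  ccell [< >] [< rV_ g ⊠ id1 f; a_ g (one w) f; id1 g ⊠ l_ f >] := mcV tri_mu q2.
Definition lam_ :
  ccell [< l_ g ⊠ id1 f >] [< a_ (one x) g f; l_ (g □ f) >] := mc tri_lam q2.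
Definition rho_ :
  ccell [< id1 g ⊠ rV_ f >] [< rV_ (g □ f); a_ g f (one v) >] := mc tri_rho q2.
End Constraints.

(** [1_g □ 1_f] versus [1_(g □ f)] in one of the factors of [□]. *)
Definition idbox_l (w x y z : T) (g : Hom y z) (f : Hom x y) (h h' : Hom w x)
    (s : hom1 h h') : ccell [< id1 g ⊠ id1 f ⊠ s >] [< id1 (g □ f) ⊠ s >] :=
  box2 (midV bx (⟨g, f⟩ : prodB (Hom y z) (Hom x y))) (id2 s).
Definition idbox_r (x y z w : T) (g : Hom y z) (f : Hom x y) (h h' : Hom z w)
    (s : hom1 h h') : ccell [< s ⊠ (id1 g ⊠ id1 f) >] [< s ⊠ id1 (g □ f) >] :=
  box2 (id2 s) (midV bx (⟨g, f⟩ : prodB (Hom y z) (Hom x y))).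

End Components.

(** The non-abelian 4-cocycle condition: the two pastings of pentagonators
   from [(((a b) c) d) e] to [a (b (c (d e)))]. *)
Definition cocycle_src (T : TriData) (u v w x y z : T) (a : Hom y z)
    (b : Hom x y) (c : Hom w x) (d : Hom v w) (e : Hom u v) :=
  [< a_ a b c ⊠ id1 d ⊠ id1 e; a_ a (b □ c) d ⊠ id1 e;
     id1 a ⊠ a_ b c d ⊠ id1 e; a_ a (b □ (c □ d)) e;
     id1 a ⊠ a_ b (c □ d) e; id1 a ⊠ (id1 b ⊠ a_ c d e) >].

Definition cocycle_tgt (T : TriData) (u v w x y z : T) (a : Hom y z)
    (b : Hom x y) (c : Hom w x) (d : Hom v w) (e : Hom u v) :=
  [< a_ (a □ b □ c) d e; a_ (a □ b) c (d □ e); a_ a b (c □ (d □ e)) >].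

Definition cocycle_lhs (T : TriData) (u v w x y z : T) (a : Hom y z)
    (b : Hom x y) (c : Hom w x) (d : Hom v w) (e : Hom u v) :
  ccell (cocycle_src a b c d e) (cocycle_tgt a b c d e) :=
  [< >] ◃ mapcell (boxr e) (pi_ a b c d) ▹
    [< a_ a (b □ (c □ d)) e; id1 a ⊠ a_ b (c □ d) e;
       id1 a ⊠ (id1 b ⊠ a_ c d e) >]
  ⋄ [< a_ (a □ b) c d ⊠ id1 e >] ◃ pi_ a b (c □ d) e ▹
    [< id1 a ⊠ (id1 b ⊠ a_ c d e) >]
  ⋄ [< a_ (a □ b) c d ⊠ id1 e; a_ (a □ b) (c □ d) e >] ◃
    a_nat (id1 a) (id1 b) (a_ c d e) ▹ [< >]
  ⋄ [< a_ (a □ b) c d ⊠ id1 e; a_ (a □ b) (c □ d) e >] ◃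
    idbox_l a b (a_ c d e) ▹ [< a_ a b (c □ (d □ e)) >]
  ⋄ [< >] ◃ pi_ (a □ b) c d e ▹ [< a_ a b (c □ (d □ e)) >].

Definition cocycle_rhs (T : TriData) (u v w x y z : T) (a : Hom y z)
    (b : Hom x y) (c : Hom w x) (d : Hom v w) (e : Hom u v) :
  ccell (cocycle_src a b c d e) (cocycle_tgt a b c d e) :=
  [< a_ a b c ⊠ id1 d ⊠ id1 e; a_ a (b □ c) d ⊠ id1 e >] ◃
    a_natV (id1 a) (a_ b c d) (id1 e) ▹
    [< id1 a ⊠ a_ b (c □ d) e; id1 a ⊠ (id1 b ⊠ a_ c d e) >]
  ⋄ [< a_ a b c ⊠ id1 d ⊠ id1 e; a_ a (b □ c) d ⊠ id1 e;
       a_ a (b □ c □ d) e >] ◃ mapcell (boxl a) (pi_ b c d e) ▹ [< >]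
  ⋄ [< a_ a b c ⊠ id1 d ⊠ id1 e >] ◃ pi_ a (b □ c) d e ▹
    [< id1 a ⊠ a_ b c (d □ e) >]
  ⋄ [< >] ◃ a_natV (a_ a b c) (id1 d) (id1 e) ▹
    [< a_ a (b □ c) (d □ e); id1 a ⊠ a_ b c (d □ e) >]
  ⋄ [< a_ (a □ b □ c) d e >] ◃ idbox_r d e (a_ a b c) ▹
    [< a_ a (b □ c) (d □ e); id1 a ⊠ a_ b c (d □ e) >]
  ⋄ [< a_ (a □ b □ c) d e >] ◃ pi_ a b c (d □ e) ▹ [< >].

(** Left normalization: the two ways to remove the unit from [((h 1) g) f]. *)
Definition lnorm_src (T : TriData) (w x y z : T) (h : Hom y z) (g : Hom x y)
    (f : Hom w x) :=
  [< rV_ h ⊠ id1 g ⊠ id1 f; a_ h (one y) g ⊠ id1 f; a_ h (one y □ g) f;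
     id1 h ⊠ (l_ g ⊠ id1 f) >].

Definition lnorm_lhs (T : TriData) (w x y z : T) (h : Hom y z) (g : Hom x y)
    (f : Hom w x) : ccell (lnorm_src h g f) [< a_ h g f >] :=
  [< rV_ h ⊠ id1 g ⊠ id1 f; a_ h (one y) g ⊠ id1 f >] ◃
    a_nat (id1 h) (l_ g) (id1 f) ▹ [< >]
  ⋄ [< >] ◃ mapcell (boxr f) (mu_ h g) ▹ [< a_ h g f >].

Definition lnorm_rhs (T : TriData) (w x y z : T) (h : Hom y z) (g : Hom x y)
    (f : Hom w x) : ccell (lnorm_src h g f) [< a_ h g f >] :=
  [< rV_ h ⊠ id1 g ⊠ id1 f; a_ h (one y) g ⊠ id1 f; a_ h (one y □ g) f >] ◃
    mapcell (boxl h) (lam_ g f) ▹ [< >]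
  ⋄ [< rV_ h ⊠ id1 g ⊠ id1 f >] ◃ pi_ h (one y) g f ▹
    [< id1 h ⊠ l_ (g □ f) >]
  ⋄ [< >] ◃ a_natV (rV_ h) (id1 g) (id1 f) ▹
    [< a_ h (one y) (g □ f); id1 h ⊠ l_ (g □ f) >]
  ⋄ [< a_ h g f >] ◃ idbox_r g f (rV_ h) ▹
    [< a_ h (one y) (g □ f); id1 h ⊠ l_ (g □ f) >]
  ⋄ [< a_ h g f >] ◃ mu_ h (g □ f) ▹ [< >].

(** Right normalization: the two ways to remove the unit from [(h (g 1)) f]. *)
Definition rnorm_src (T : TriData) (w x y z : T) (h : Hom y z) (g : Hom x y)
    (f : Hom w x) :=
  [< id1 h ⊠ rV_ g ⊠ id1 f; a_ h (g □ one x) f; id1 h ⊠ a_ g (one x) f;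
     id1 h ⊠ (id1 g ⊠ l_ f) >].

Definition rnorm_lhs (T : TriData) (w x y z : T) (h : Hom y z) (g : Hom x y)
    (f : Hom w x) : ccell (rnorm_src h g f) [< a_ h g f >] :=
  [< >] ◃ a_natV (id1 h) (rV_ g) (id1 f) ▹
    [< id1 h ⊠ a_ g (one x) f; id1 h ⊠ (id1 g ⊠ l_ f) >]
  ⋄ [< a_ h g f >] ◃ mapcell (boxl h) (mu_ g f) ▹ [< >].

Definition rnorm_rhs (T : TriData) (w x y z : T) (h : Hom y z) (g : Hom x y)
    (f : Hom w x) : ccell (rnorm_src h g f) [< a_ h g f >] :=
  [< >] ◃ mapcell (boxr f) (rho_ h g) ▹
    [< a_ h (g □ one x) f; id1 h ⊠ a_ g (one x) f; id1 h ⊠ (id1 g ⊠ l_ f) >]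
  ⋄ [< rV_ (h □ g) ⊠ id1 f >] ◃ pi_ h g (one x) f ▹
    [< id1 h ⊠ (id1 g ⊠ l_ f) >]
  ⋄ [< rV_ (h □ g) ⊠ id1 f; a_ (h □ g) (one x) f >] ◃
    a_nat (id1 h) (id1 g) (l_ f) ▹ [< >]
  ⋄ [< rV_ (h □ g) ⊠ id1 f; a_ (h □ g) (one x) f >] ◃
    idbox_l h g (l_ f) ▹ [< a_ h g f >]
  ⋄ [< >] ◃ mu_ (h □ g) f ▹ [< a_ h g f >].

Record TriLaws (T : TriData) : Prop := {
  Hom_laws : forall x y : T, BicatLaws (Hom x y);
  bx_laws : forall x y z : T, PFunLaws (@bx T x y z);
  un_laws : forall x : T, PFunLaws (un x);
  ta_laws : forall x y z w : T, AdjEqLaws (@ta_adj T (tri_au T) x y z w);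
  tlu_laws : forall x y : T, AdjEqLaws (@tlu_adj T (tri_au T) x y);
  tru_laws : forall x y : T, AdjEqLaws (@tru_adj T (tri_au T) x y);
  pi_laws : forall v w x y z : T, ModLaws (@tri_pi T v w x y z);
  mu_laws : forall x y z : T, ModLaws (@tri_mu T x y z);
  lam_laws : forall x y z : T, ModLaws (@tri_lam T x y z);
  rho_laws : forall x y z : T, ModLaws (@tri_rho T x y z);
  cocycle : forall (u v w x y z : T) (a : Hom y z) (b : Hom x y) (c : Hom w x)
    (d : Hom v w) (e : Hom u v), cocycle_lhs a b c d e ≈ cocycle_rhs a b c d e;
  lnorm : forall (w x y z : T) (h : Hom y z) (g : Hom x y) (f : Hom w x),
    lnorm_lhs h g f ≈ lnorm_rhs h g f;
  rnorm : forall (w x y z : T) (h : Hom y z) (g : Hom x y) (f : Hom w x),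
    rnorm_lhs h g f ≈ rnorm_rhs h g f
}.

Record Tricat := { tricat_data :> TriData; tricat_laws : TriLaws tricat_data }.

(** * 3-traces

   [TraceData] contains the part of a 3-trace that occurs in the two axioms and
   in the formal 2-graph; the pseudo-inverses of the φ(x,y) are added in
   [Trace3]. *)

Record TracePhi (T : TriData) (B : BicatData) := MkTracePhi {
  trF : forall x : T, PFunData (Hom x x) B;
  phiT : forall x y : T, TransData (A := prodB (Hom x y) (Hom y x))
    (compF (trF y) (fstF ⊡ sndF)) (compF (trF x) (sndF ⊡ fstF))
}.
Arguments trF {T B} _ x.
Arguments phiT {T B} _ x y.

Section TraceInContext.
Context {T : TriData} {B : BicatData} (P : TracePhi T B) {Q : BicatData}.

Definition phiC (x y : T) (F : PFunData Q (Hom x y)) (G : PFunData Q (Hom y x)) :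
  TransData (compF (trF P y) (F ⊡ G)) (compF (trF P x) (G ⊡ F)) :=
  tpre (phiT P x y) (pairF F G).

Definition trC (x : T) (F G : PFunData Q (Hom x x)) (σ : TransData F G) :
  TransData (compF (trF P x) F) (compF (trF P x) G) := tpost (trF P x) σ.

Definition m_src (x y z : T) (F3 : PFunData Q (Hom z x))
    (F2 : PFunData Q (Hom y z)) (F1 : PFunData Q (Hom x y)) :
  TransData (compF (trF P x) (F3 ⊡ F2 ⊡ F1)) (compF (trF P z) (F2 ⊡ F1 ⊡ F3)) :=
  phiC (F3 ⊡ F2) F1 ⨾ trC (aVT (tri_au T) F1 F3 F2)
    ⨾ phiC (F1 ⊡ F3) F2 ⨾ trC (aVT (tri_au T) F2 F1 F3).
Definition m_tgt (x y z : T) (F3 : PFunData Q (Hom z x))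
    (F2 : PFunData Q (Hom y z)) (F1 : PFunData Q (Hom x y)) :
  TransData (compF (trF P x) (F3 ⊡ F2 ⊡ F1)) (compF (trF P z) (F2 ⊡ F1 ⊡ F3)) :=
  trC (aT (tri_au T) F3 F2 F1) ⨾ phiC F3 (F2 ⊡ F1).

Definition kappa_src (x : T) (F : PFunData Q (Hom x x)) :
  TransData (compF (trF P x) F) (compF (trF P x) F) :=
  trC (lVT (tri_au T) F) ⨾ phiC unitF F ⨾ trC (rT (tri_au T) F).
End TraceInContext.

Record TraceData (T : TriData) (B : BicatData) := MkTrace {
  tr_phi :> TracePhi T B;
  tr_m : forall x y z : T,
    ModData (A := prodB (Hom z x) (prodB (Hom y z) (Hom x y)))
      (m_src tr_phi v31 v32 v33) (m_tgt tr_phi v31 v32 v33);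
  tr_kappa : forall x : T,
    ModData (A := Hom x x) (kappa_src tr_phi idF) (tid (trF tr_phi x))
}.
Arguments tr_m {T B} _ {x y z}.
Arguments tr_kappa {T B} _ {x}.

(** Pentagonators rearranged so as to contain inverse associators. *)
Section PentagonMates.
Context {T : TriData} {v w x y z : T}.
Context (k : Hom y z) (h : Hom x y) (g : Hom w x) (f : Hom v w).

Definition pi_mate1 :
  ccell [< id1 k ⊠ a_ h g f; aV_ k h (g □ f); aV_ (k □ h) g f >]
        [< aV_ k (h □ g) f; aV_ k h g ⊠ id1 f >] :=
  [< >] ◃ aVa_i k (h □ g) f ▹
    [< id1 k ⊠ a_ h g f; aV_ k h (g □ f); aV_ (k □ h) g f >]
  ⋄ [< aV_ k (h □ g) f >] ◃ mapcell (boxr f) (aVa_i k h g) ▹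
    [< a_ k (h □ g) f; id1 k ⊠ a_ h g f; aV_ k h (g □ f); aV_ (k □ h) g f >]
  ⋄ [< aV_ k (h □ g) f; aV_ k h g ⊠ id1 f >] ◃ pi_ k h g f ▹
    [< aV_ k h (g □ f); aV_ (k □ h) g f >]
  ⋄ [< aV_ k (h □ g) f; aV_ k h g ⊠ id1 f; a_ (k □ h) g f >] ◃
    aaV k h (g □ f) ▹ [< aV_ (k □ h) g f >]
  ⋄ [< aV_ k (h □ g) f; aV_ k h g ⊠ id1 f >] ◃ aaV (k □ h) g f ▹ [< >].

Definition pi_mate2 :
  ccell [< id1 k ⊠ aV_ h g f; aV_ k (h □ g) f >]
        [< aV_ k h (g □ f); aV_ (k □ h) g f; a_ k h g ⊠ id1 f >] :=
  [< >] ◃ aVa_i k h (g □ f) ▹ [< id1 k ⊠ aV_ h g f; aV_ k (h □ g) f >]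
  ⋄ [< aV_ k h (g □ f) >] ◃ aVa_i (k □ h) g f ▹
    [< a_ k h (g □ f); id1 k ⊠ aV_ h g f; aV_ k (h □ g) f >]
  ⋄ [< aV_ k h (g □ f); aV_ (k □ h) g f >] ◃ piV_ k h g f ▹
    [< id1 k ⊠ aV_ h g f; aV_ k (h □ g) f >]
  ⋄ [< aV_ k h (g □ f); aV_ (k □ h) g f; a_ k h g ⊠ id1 f;
       a_ k (h □ g) f >] ◃ mapcell (boxl k) (aaV h g f) ▹
    [< aV_ k (h □ g) f >]
  ⋄ [< aV_ k h (g □ f); aV_ (k □ h) g f; a_ k h g ⊠ id1 f >] ◃
    aaV k (h □ g) f ▹ [< >].

Definition pi_mate3 :
  ccell [< id1 k ⊠ a_ h g f; aV_ k h (g □ f); aV_ (k □ h) g f;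
           a_ k h g ⊠ id1 f >]
        [< aV_ k (h □ g) f >] :=
  [< >] ◃ pi_mate1 ▹ [< a_ k h g ⊠ id1 f >]
  ⋄ [< aV_ k (h □ g) f >] ◃ mapcell (boxr f) (aVa k h g) ▹ [< >].
End PentagonMates.

Section UnitMates.
Context {T : TriData} {x y z : T} (g : Hom y z) (f : Hom x y).

Definition lam_mate : ccell [< lV_ (g □ f) >] [< lV_ g ⊠ id1 f; a_ (one z) g f >] :=
  [< >] ◃ mapcell (boxr f) (lVl_i g) ▹ [< lV_ (g □ f) >]
  ⋄ [< lV_ g ⊠ id1 f >] ◃ lam_ g f ▹ [< lV_ (g □ f) >]
  ⋄ [< lV_ g ⊠ id1 f; a_ (one z) g f >] ◃ llV (g □ f) ▹ [< >].

Definition rho_mate : ccell [< aV_ g f (one x); r_ (g □ f) >] [< id1 g ⊠ r_ f >] :=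
  [< >] ◃ mapcell (boxl g) (rrV_i f) ▹ [< aV_ g f (one x); r_ (g □ f) >]
  ⋄ [< id1 g ⊠ r_ f >] ◃ rho_ g f ▹ [< aV_ g f (one x); r_ (g □ f) >]
  ⋄ [< id1 g ⊠ r_ f; rV_ (g □ f) >] ◃ aaV g f (one x) ▹ [< r_ (g □ f) >]
  ⋄ [< id1 g ⊠ r_ f >] ◃ rVr (g □ f) ▹ [< >].

Definition mu_mate :
  ccell [< id1 g ⊠ lV_ f; aV_ g (one y) f; r_ g ⊠ id1 f >] [< >] :=
  [< >] ◃ muV_ g f ▹ [< id1 g ⊠ lV_ f; aV_ g (one y) f; r_ g ⊠ id1 f >]
  ⋄ [< rV_ g ⊠ id1 f; a_ g (one y) f >] ◃ mapcell (boxl g) (llV f) ▹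
    [< aV_ g (one y) f; r_ g ⊠ id1 f >]
  ⋄ [< rV_ g ⊠ id1 f >] ◃ aaV g (one y) f ▹ [< r_ g ⊠ id1 f >]
  ⋄ [< >] ◃ mapcell (boxr f) (rVr g) ▹ [< >].
End UnitMates.

Section TraceComponents.
Context {T : TriData} {B : BicatData} (P : TraceData T B).

Definition tr1 (x : T) (f g : Hom x x) (s : hom1 f g) :
  hom1 (trF P x f) (trF P x g) := r1 (trF P x) s.

Definition phi_ (x y : T) (f : Hom x y) (g : Hom y x) :
  hom1 (trF P y (f □ g)) (trF P x (g □ f)) :=
  tc (phiT P x y) (⟨f, g⟩ : prodB (Hom x y) (Hom y x)).

Section Naturality.
Context {x y : T} {f f' : Hom x y} {g g' : Hom y x}.
Context (s : hom1 f f') (t : hom1 g g').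
Notation st :=
  (⟨s, t⟩ : @hom1 (prodB (Hom x y) (Hom y x)) ⟨f, g⟩ ⟨f', g'⟩).
Definition phi_nat :
  ccell [< phi_ f g; tr1 (t ⊠ s) >] [< tr1 (s ⊠ t); phi_ f' g' >] :=
  tn (phiT P x y) st.
Definition phi_natV :
  ccell [< tr1 (s ⊠ t); phi_ f' g' >] [< phi_ f g; tr1 (t ⊠ s) >] :=
  tnV (phiT P x y) st.
End Naturality.

Section MComponents.
Context {x y z : T} (f3 : Hom z x) (f2 : Hom y z) (f1 : Hom x y).
Notation q := (⟨f3, ⟨f2, f1⟩⟩ : prodB (Hom z x) (prodB (Hom y z) (Hom x y))).
Definition m_ : ccell
    [< phi_ (f3 □ f2) f1; tr1 (aV_ f1 f3 f2);
       phi_ (f1 □ f3) f2; tr1 (aV_ f2 f1 f3) >]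
    [< tr1 (a_ f3 f2 f1); phi_ f3 (f2 □ f1) >] := mc (tr_m P) q.
Definition mV_ : ccell
    [< tr1 (a_ f3 f2 f1); phi_ f3 (f2 □ f1) >]
    [< phi_ (f3 □ f2) f1; tr1 (aV_ f1 f3 f2);
       phi_ (f1 □ f3) f2; tr1 (aV_ f2 f1 f3) >] := mcV (tr_m P) q.
End MComponents.

Definition kappaV_ (x : T) (f : Hom x x) :
  ccell [< >] [< tr1 (lV_ f); phi_ (one x) f; tr1 (r_ f) >] := mcV (tr_kappa P) f.

(** ** The cyclic axiom

     m(4,3,21) · (id ∘ m(43,2,1)) = m(4,32,1) · (m(14,3,2) ∘ id)

   as 2-cells φ(214,3) ∘ φ(143,2) ∘ φ(432,1) => φ(4,321), with the suppressed
   associators written out.  Both pastings start from the string in which the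
   words are bracketed as for the right-hand side, preceded by
   (43)2 -> 4(32) and followed by (32)1 -> 3(21); the remaining rebracketings
   are pentagonators and naturality cells of φ. *)
Section CyclicAxiom.
Context {w x y z : T}.
Context (f4 : Hom w x) (f3 : Hom z w) (f2 : Hom y z) (f1 : Hom x y).

Definition cyc_src :=
  [< tr1 (a_ f4 f3 f2 ⊠ id1 f1);
     phi_ (f4 □ (f3 □ f2)) f1; tr1 (aV_ f1 f4 (f3 □ f2));
     tr1 (aV_ (f1 □ f4) f3 f2);
     phi_ (f1 □ f4 □ f3) f2; tr1 (aV_ f2 (f1 □ f4) f3);
     phi_ (f2 □ (f1 □ f4)) f3; tr1 (aV_ f3 f2 (f1 □ f4));
     tr1 (aV_ (f3 □ f2) f1 f4);
     tr1 (a_ f3 f2 f1 ⊠ id1 f4) >].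

Definition cyc_tgt :=
  [< tr1 (a_ (f4 □ f3) f2 f1); tr1 (a_ f4 f3 (f2 □ f1));
     phi_ f4 (f3 □ (f2 □ f1)) >].

(** Rebracketing, then m(43,2,1) and m(4,3,21). *)
Definition cyc_lhs : ccell cyc_src cyc_tgt :=
  [< >] ◃ phi_natV (a_ f4 f3 f2) (id1 f1) ▹
    [< tr1 (aV_ f1 f4 (f3 □ f2)); tr1 (aV_ (f1 □ f4) f3 f2);
       phi_ (f1 □ f4 □ f3) f2; tr1 (aV_ f2 (f1 □ f4) f3);
       phi_ (f2 □ (f1 □ f4)) f3; tr1 (aV_ f3 f2 (f1 □ f4));
       tr1 (aV_ (f3 □ f2) f1 f4); tr1 (a_ f3 f2 f1 ⊠ id1 f4) >]
  ⋄ [< phi_ (f4 □ f3 □ f2) f1 >] ◃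
    mapcell (trF P y) (pi_mate1 f1 f4 f3 f2) ▹
    [< phi_ (f1 □ f4 □ f3) f2; tr1 (aV_ f2 (f1 □ f4) f3);
       phi_ (f2 □ (f1 □ f4)) f3; tr1 (aV_ f3 f2 (f1 □ f4));
       tr1 (aV_ (f3 □ f2) f1 f4); tr1 (a_ f3 f2 f1 ⊠ id1 f4) >]
  ⋄ [< phi_ (f4 □ f3 □ f2) f1; tr1 (aV_ f1 (f4 □ f3) f2) >] ◃
    phi_natV (aV_ f1 f4 f3) (id1 f2) ▹
    [< tr1 (aV_ f2 (f1 □ f4) f3);
       phi_ (f2 □ (f1 □ f4)) f3; tr1 (aV_ f3 f2 (f1 □ f4));
       tr1 (aV_ (f3 □ f2) f1 f4); tr1 (a_ f3 f2 f1 ⊠ id1 f4) >]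
  ⋄ [< phi_ (f4 □ f3 □ f2) f1; tr1 (aV_ f1 (f4 □ f3) f2);
       phi_ (f1 □ (f4 □ f3)) f2 >] ◃
    mapcell (trF P z) (pi_mate2 f2 f1 f4 f3) ▹
    [< phi_ (f2 □ (f1 □ f4)) f3; tr1 (aV_ f3 f2 (f1 □ f4));
       tr1 (aV_ (f3 □ f2) f1 f4); tr1 (a_ f3 f2 f1 ⊠ id1 f4) >]
  ⋄ [< phi_ (f4 □ f3 □ f2) f1; tr1 (aV_ f1 (f4 □ f3) f2);
       phi_ (f1 □ (f4 □ f3)) f2; tr1 (aV_ f2 f1 (f4 □ f3));
       tr1 (aV_ (f2 □ f1) f4 f3) >] ◃
    phi_natV (a_ f2 f1 f4) (id1 f3) ▹
    [< tr1 (aV_ f3 f2 (f1 □ f4)); tr1 (aV_ (f3 □ f2) f1 f4);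
       tr1 (a_ f3 f2 f1 ⊠ id1 f4) >]
  ⋄ [< phi_ (f4 □ f3 □ f2) f1; tr1 (aV_ f1 (f4 □ f3) f2);
       phi_ (f1 □ (f4 □ f3)) f2; tr1 (aV_ f2 f1 (f4 □ f3));
       tr1 (aV_ (f2 □ f1) f4 f3); phi_ (f2 □ f1 □ f4) f3 >] ◃
    mapcell (trF P w) (pi_mate3 f3 f2 f1 f4) ▹ [< >]
  ⋄ [< >] ◃ m_ (f4 □ f3) f2 f1 ▹
    [< tr1 (aV_ (f2 □ f1) f4 f3); phi_ (f2 □ f1 □ f4) f3;
       tr1 (aV_ f3 (f2 □ f1) f4) >]
  ⋄ [< tr1 (a_ (f4 □ f3) f2 f1) >] ◃ m_ f4 f3 (f2 □ f1) ▹ [< >].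

(** m(14,3,2) and m(4,32,1), then rebracketing. *)
Definition cyc_rhs : ccell cyc_src cyc_tgt :=
  [< tr1 (a_ f4 f3 f2 ⊠ id1 f1); phi_ (f4 □ (f3 □ f2)) f1;
     tr1 (aV_ f1 f4 (f3 □ f2)); tr1 (aV_ (f1 □ f4) f3 f2) >] ◃
    m_ (f1 □ f4) f3 f2 ▹
    [< tr1 (aV_ (f3 □ f2) f1 f4); tr1 (a_ f3 f2 f1 ⊠ id1 f4) >]
  ⋄ [< tr1 (a_ f4 f3 f2 ⊠ id1 f1); phi_ (f4 □ (f3 □ f2)) f1;
       tr1 (aV_ f1 f4 (f3 □ f2)) >] ◃
    mapcell (trF P y) (aVa (f1 □ f4) f3 f2) ▹
    [< phi_ (f1 □ f4) (f3 □ f2); tr1 (aV_ (f3 □ f2) f1 f4);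
       tr1 (a_ f3 f2 f1 ⊠ id1 f4) >]
  ⋄ [< tr1 (a_ f4 f3 f2 ⊠ id1 f1) >] ◃ m_ f4 (f3 □ f2) f1 ▹
    [< tr1 (a_ f3 f2 f1 ⊠ id1 f4) >]
  ⋄ [< tr1 (a_ f4 f3 f2 ⊠ id1 f1); tr1 (a_ f4 (f3 □ f2) f1) >] ◃
    phi_nat (id1 f4) (a_ f3 f2 f1) ▹ [< >]
  ⋄ [< >] ◃ mapcell (trF P x) (pi_ f4 f3 f2 f1) ▹ [< phi_ f4 (f3 □ (f2 □ f1)) >].
End CyclicAxiom.

(** ** The unit u_(f,g) : 1 => φ(g,f) ∘ φ(f,g)

   κ^-1 at f □ g and m(1,f,g)^-1, joined by the unit constraints λ and ρ;
   then naturality of φ moves l^- and r through φ(1 □ f, g) and φ(g □ 1, f),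
   and the remaining composite g □ f -> (g □ 1) □ f -> g □ f is removed by μ. *)
Definition u_ (x y : T) (f : Hom x y) (g : Hom y x) :
  ccell [< >] [< phi_ f g; phi_ g f >] :=
  kappaV_ (f □ g)
  ⋄ [< >] ◃ mapcell (trF P y) (lam_mate f g) ▹
    [< phi_ (one y) (f □ g); tr1 (r_ (f □ g)) >]
  ⋄ [< tr1 (lV_ f ⊠ id1 g) >] ◃ mV_ (one y) f g ▹ [< tr1 (r_ (f □ g)) >]
  ⋄ [< >] ◃ phi_natV (lV_ f) (id1 g) ▹
    [< tr1 (aV_ g (one y) f); phi_ (g □ one y) f; tr1 (aV_ f g (one y));
       tr1 (r_ (f □ g)) >]
  ⋄ [< phi_ f g; tr1 (id1 g ⊠ lV_ f); tr1 (aV_ g (one y) f);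
       phi_ (g □ one y) f >] ◃ mapcell (trF P y) (rho_mate f g) ▹ [< >]
  ⋄ [< phi_ f g; tr1 (id1 g ⊠ lV_ f); tr1 (aV_ g (one y) f) >] ◃
    phi_nat (r_ g) (id1 f) ▹ [< >]
  ⋄ [< phi_ f g >] ◃ mapcell (trF P x) (mu_mate g f) ▹ [< phi_ g f >].

End TraceComponents.

Record TraceLaws (T : TriData) (B : BicatData) (P : TraceData T B) : Prop := {
  trF_laws : forall x : T, PFunLaws (trF P x);
  phi_laws : forall x y : T, @TransLaws _ _
    (compF (trF P y) (fstF ⊡ sndF)) (compF (trF P x) (sndF ⊡ fstF)) (phiT P x y);
  m_laws : forall x y z : T, ModLaws (@tr_m T B P x y z);
  kappa_laws : forall x : T, ModLaws (@tr_kappa T B P x);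
  cyclic_axiom : forall (w x y z : T) (f4 : Hom w x) (f3 : Hom z w)
    (f2 : Hom y z) (f1 : Hom x y),
    cyc_lhs P f4 f3 f2 f1 ≈ cyc_rhs P f4 f3 f2 f1;
  (* φ(f,g) and φ(g,f) are adjoint with unit u_(f,g) and counit the inverse
     of u_(g,f). *)
  u_snake : forall (x y : T) (f : Hom x y) (g : Hom y x)
    (ε : ccell [< phi_ P g f; phi_ P f g >] [< >]), inverse2 (u_ P g f) ε ->
    [< >] ◃ u_ P f g ▹ [< phi_ P f g >] ⋄ [< phi_ P f g >] ◃ ε ▹ [< >]
    ≈ id2 (phi_ P f g);
  u_snakeV : forall (x y : T) (f : Hom x y) (g : Hom y x)
    (ε : ccell [< phi_ P g f; phi_ P f g >] [< >]), inverse2 (u_ P g f) ε ->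
    [< phi_ P g f >] ◃ u_ P f g ▹ [< >] ⋄ [< >] ◃ ε ▹ [< phi_ P g f >]
    ≈ id2 (phi_ P g f)
}.

Record Trace3 (T : Tricat) (B : Bicat) := {
  trace_data :> TraceData T B;
  phi_adj : forall x y : T, AdjEqData (phiT trace_data x y);
  trace_laws : TraceLaws trace_data;
  phi_adj_laws : forall x y : T, @AdjEqLaws _ _
    (compF (trF trace_data y) (fstF ⊡ sndF))
    (compF (trF trace_data x) (sndF ⊡ fstF)) _ (phi_adj x y)
}.

(** * The formal 2-graph

   [gen] is a graph of letters; the letters for cyclic strings of length [n]
   are given by [letter n] below.  Words are typed by their end points. *)

Section Formal.
Context {V : Type} {gen : V -> V -> Type}.

Inductive word : V -> V -> Type :=
| w_gen x y : gen x y -> word x y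
| w_one x : word x x
| w_box x y z : word y z -> word x y -> word x z.

Fixpoint wlen (x y : V) (b : word x y) : nat :=
  match b with
  | w_gen _ _ _ => 1
  | w_one _ => 0
  | w_box _ _ _ b c => wlen b + wlen c
  end.

(** [f_un] is the value of the unit 2-functor on
   the identity 1-cell, which is isomorphic to [f_id]. *)
Inductive form1 : forall x y : V, word x y -> word x y -> Type :=
| f_id x y (b : word x y) : form1 b b
| f_comp x y (b c d : word x y) : form1 c d -> form1 b c -> form1 b d
| f_box x y z (b b' : word y z) (c c' : word x y) :
    form1 b b' -> form1 c c' -> form1 (w_box b c) (w_box b' c')
| f_un x : form1 (w_one x) (w_one x)
| f_a x y z w (b : word z w) (c : word y z) (d : word x y) :
    form1 (w_box (w_box b c) d) (w_box b (w_box c d))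
| f_aV x y z w (b : word z w) (c : word y z) (d : word x y) :
    form1 (w_box b (w_box c d)) (w_box (w_box b c) d)
| f_l x y (b : word x y) : form1 (w_box (w_one y) b) b
| f_lV x y (b : word x y) : form1 b (w_box (w_one y) b)
| f_r x y (b : word x y) : form1 (w_box b (w_one x)) b
| f_rV x y (b : word x y) : form1 b (w_box b (w_one x)).

Inductive form2 : forall (x y : V) (b c : word x y),
  form1 b c -> form1 b c -> Type :=
| c_id x y (b c : word x y) (s : form1 b c) : form2 s s
| c_vcomp x y (b c : word x y) (s t u : form1 b c) :
    form2 t u -> form2 s t -> form2 s u
| c_hcomp x y (b c d : word x y) (t t' : form1 c d) (s s' : form1 b c) :
    form2 t t' -> form2 s s' -> form2 (f_comp t s) (f_comp t' s')
| c_lun x y (b c : word x y) (s : form1 b c) : form2 (f_comp (f_id c) s) s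
| c_lunV x y (b c : word x y) (s : form1 b c) : form2 s (f_comp (f_id c) s)
| c_run x y (b c : word x y) (s : form1 b c) : form2 (f_comp s (f_id b)) s
| c_runV x y (b c : word x y) (s : form1 b c) : form2 s (f_comp s (f_id b))
| c_asc x y (b c d e : word x y) (u : form1 d e) (t : form1 c d) (s : form1 b c) :
    form2 (f_comp (f_comp u t) s) (f_comp u (f_comp t s))
| c_ascV x y (b c d e : word x y) (u : form1 d e) (t : form1 c d) (s : form1 b c) :
    form2 (f_comp u (f_comp t s)) (f_comp (f_comp u t) s)
| c_box x y z (b b' : word y z) (c c' : word x y) (s s' : form1 b b')
    (t t' : form1 c c') : form2 s s' -> form2 t t' -> form2 (f_box s t) (f_box s' t')
| c_box_comp x y z (b b' b'' : word y z) (c c' c'' : word x y)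
    (s' : form1 b' b'') (t' : form1 c' c'') (s : form1 b b') (t : form1 c c') :
    form2 (f_comp (f_box s' t') (f_box s t)) (f_box (f_comp s' s) (f_comp t' t))
| c_box_compV x y z (b b' b'' : word y z) (c c' c'' : word x y)
    (s' : form1 b' b'') (t' : form1 c' c'') (s : form1 b b') (t : form1 c c') :
    form2 (f_box (f_comp s' s) (f_comp t' t)) (f_comp (f_box s' t') (f_box s t))
| c_box_id x y z (b : word y z) (c : word x y) :
    form2 (f_id (w_box b c)) (f_box (f_id b) (f_id c))
| c_box_idV x y z (b : word y z) (c : word x y) :
    form2 (f_box (f_id b) (f_id c)) (f_id (w_box b c))
| c_un x : form2 (f_un x) (f_un x)
| c_un_comp x : form2 (f_comp (f_un x) (f_un x)) (f_un x)
| c_un_compV x : form2 (f_un x) (f_comp (f_un x) (f_un x))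
| c_un_id x : form2 (f_id (w_one x)) (f_un x)
| c_un_idV x : form2 (f_un x) (f_id (w_one x))
| c_a x y z w (b b' : word z w) (c c' : word y z) (d d' : word x y)
    (u : form1 b b') (t : form1 c c') (s : form1 d d') :
    form2 (f_comp (f_box u (f_box t s)) (f_a b c d))
          (f_comp (f_a b' c' d') (f_box (f_box u t) s))
| c_a' x y z w (b b' : word z w) (c c' : word y z) (d d' : word x y)
    (u : form1 b b') (t : form1 c c') (s : form1 d d') :
    form2 (f_comp (f_a b' c' d') (f_box (f_box u t) s))
          (f_comp (f_box u (f_box t s)) (f_a b c d))
| c_aV x y z w (b b' : word z w) (c c' : word y z) (d d' : word x y)
    (u : form1 b b') (t : form1 c c') (s : form1 d d') :
    form2 (f_comp (f_box (f_box u t) s) (f_aV b c d))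
          (f_comp (f_aV b' c' d') (f_box u (f_box t s)))
| c_aV' x y z w (b b' : word z w) (c c' : word y z) (d d' : word x y)
    (u : form1 b b') (t : form1 c c') (s : form1 d d') :
    form2 (f_comp (f_aV b' c' d') (f_box u (f_box t s)))
          (f_comp (f_box (f_box u t) s) (f_aV b c d))
| c_l x y (b b' : word x y) (s : form1 b b') :
    form2 (f_comp s (f_l b)) (f_comp (f_l b') (f_box (f_un y) s))
| c_l' x y (b b' : word x y) (s : form1 b b') :
    form2 (f_comp (f_l b') (f_box (f_un y) s)) (f_comp s (f_l b))
| c_lV x y (b b' : word x y) (s : form1 b b') :
    form2 (f_comp (f_box (f_un y) s) (f_lV b)) (f_comp (f_lV b') s)
| c_lV' x y (b b' : word x y) (s : form1 b b') :
    form2 (f_comp (f_lV b') s) (f_comp (f_box (f_un y) s) (f_lV b))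
| c_r x y (b b' : word x y) (s : form1 b b') :
    form2 (f_comp s (f_r b)) (f_comp (f_r b') (f_box s (f_un x)))
| c_r' x y (b b' : word x y) (s : form1 b b') :
    form2 (f_comp (f_r b') (f_box s (f_un x))) (f_comp s (f_r b))
| c_rV x y (b b' : word x y) (s : form1 b b') :
    form2 (f_comp (f_box s (f_un x)) (f_rV b)) (f_comp (f_rV b') s)
| c_rV' x y (b b' : word x y) (s : form1 b b') :
    form2 (f_comp (f_rV b') s) (f_comp (f_box s (f_un x)) (f_rV b))
| c_aη x y z w (b : word z w) (c : word y z) (d : word x y) :
    form2 (f_id (w_box (w_box b c) d)) (f_comp (f_aV b c d) (f_a b c d))
| c_aη' x y z w (b : word z w) (c : word y z) (d : word x y) :
    form2 (f_comp (f_aV b c d) (f_a b c d)) (f_id (w_box (w_box b c) d))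
| c_aε x y z w (b : word z w) (c : word y z) (d : word x y) :
    form2 (f_comp (f_a b c d) (f_aV b c d)) (f_id (w_box b (w_box c d)))
| c_aε' x y z w (b : word z w) (c : word y z) (d : word x y) :
    form2 (f_id (w_box b (w_box c d))) (f_comp (f_a b c d) (f_aV b c d))
| c_lη x y (b : word x y) : form2 (f_id (w_box (w_one y) b)) (f_comp (f_lV b) (f_l b))
| c_lη' x y (b : word x y) : form2 (f_comp (f_lV b) (f_l b)) (f_id (w_box (w_one y) b))
| c_lε x y (b : word x y) : form2 (f_comp (f_l b) (f_lV b)) (f_id b)
| c_lε' x y (b : word x y) : form2 (f_id b) (f_comp (f_l b) (f_lV b))
| c_rη x y (b : word x y) : form2 (f_id (w_box b (w_one x))) (f_comp (f_rV b) (f_r b))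
| c_rη' x y (b : word x y) : form2 (f_comp (f_rV b) (f_r b)) (f_id (w_box b (w_one x)))
| c_rε x y (b : word x y) : form2 (f_comp (f_r b) (f_rV b)) (f_id b)
| c_rε' x y (b : word x y) : form2 (f_id b) (f_comp (f_r b) (f_rV b))
| c_pi v w x y z (k : word y z) (h : word x y) (g : word w x) (f : word v w) :
    form2
      (f_comp (f_comp (f_box (f_id k) (f_a h g f)) (f_a k (w_box h g) f))
              (f_box (f_a k h g) (f_id f)))
      (f_comp (f_a k h (w_box g f)) (f_a (w_box k h) g f))
| c_pi' v w x y z (k : word y z) (h : word x y) (g : word w x) (f : word v w) :
    form2
      (f_comp (f_a k h (w_box g f)) (f_a (w_box k h) g f))
      (f_comp (f_comp (f_box (f_id k) (f_a h g f)) (f_a k (w_box h g) f))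
              (f_box (f_a k h g) (f_id f)))
| c_mu x y z (g : word y z) (f : word x y) :
    form2
      (f_comp (f_comp (f_box (f_id g) (f_l f)) (f_a g (w_one y) f))
              (f_box (f_rV g) (f_id f)))
      (f_id (w_box g f))
| c_mu' x y z (g : word y z) (f : word x y) :
    form2
      (f_id (w_box g f))
      (f_comp (f_comp (f_box (f_id g) (f_l f)) (f_a g (w_one y) f))
              (f_box (f_rV g) (f_id f)))
| c_lam x y z (g : word y z) (f : word x y) :
    form2 (f_box (f_l g) (f_id f)) (f_comp (f_l (w_box g f)) (f_a (w_one z) g f))
| c_lam' x y z (g : word y z) (f : word x y) :
    form2 (f_comp (f_l (w_box g f)) (f_a (w_one z) g f)) (f_box (f_l g) (f_id f))
| c_rho x y z (g : word y z) (f : word x y) :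
    form2 (f_box (f_id g) (f_rV f)) (f_comp (f_a g f (w_one x)) (f_rV (w_box g f)))
| c_rho' x y z (g : word y z) (f : word x y) :
    form2 (f_comp (f_a g f (w_one x)) (f_rV (w_box g f))) (f_box (f_id g) (f_rV f)).

(** A word with a cut point, and formal 1- and 2-cells between their traces. *)
Record loop := Loop { cut : V; lword : word cut cut }.

Inductive tform1 : loop -> loop -> Type :=
| t_id v : tform1 v v
| t_comp u v w : tform1 v w -> tform1 u v -> tform1 u w
| t_tr x (b c : word x x) : form1 b c -> tform1 (Loop b) (Loop c)
| t_phi x y (b : word x y) (c : word y x) :
    tform1 (Loop (w_box b c)) (Loop (w_box c b)).

Inductive tform2 : forall v w : loop, tform1 v w -> tform1 v w -> Type :=
| d_id v w (s : tform1 v w) : tform2 s s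
| d_vcomp v w (s t u : tform1 v w) : tform2 t u -> tform2 s t -> tform2 s u
| d_hcomp u v w (t t' : tform1 v w) (s s' : tform1 u v) :
    tform2 t t' -> tform2 s s' -> tform2 (t_comp t s) (t_comp t' s')
| d_lun v w (s : tform1 v w) : tform2 (t_comp (t_id w) s) s
| d_lunV v w (s : tform1 v w) : tform2 s (t_comp (t_id w) s)
| d_run v w (s : tform1 v w) : tform2 (t_comp s (t_id v)) s
| d_runV v w (s : tform1 v w) : tform2 s (t_comp s (t_id v))
| d_asc v w x y (u : tform1 x y) (t : tform1 w x) (s : tform1 v w) :
    tform2 (t_comp (t_comp u t) s) (t_comp u (t_comp t s))
| d_ascV v w x y (u : tform1 x y) (t : tform1 w x) (s : tform1 v w) :
    tform2 (t_comp u (t_comp t s)) (t_comp (t_comp u t) s)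
| d_tr x (b c : word x x) (s t : form1 b c) :
    form2 s t -> tform2 (t_tr s) (t_tr t)
| d_tr_comp x (b c d : word x x) (t : form1 c d) (s : form1 b c) :
    tform2 (t_comp (t_tr t) (t_tr s)) (t_tr (f_comp t s))
| d_tr_compV x (b c d : word x x) (t : form1 c d) (s : form1 b c) :
    tform2 (t_tr (f_comp t s)) (t_comp (t_tr t) (t_tr s))
| d_tr_id x (b : word x x) : tform2 (t_id (Loop b)) (t_tr (f_id b))
| d_tr_idV x (b : word x x) : tform2 (t_tr (f_id b)) (t_id (Loop b))
| d_phi x y (b b' : word x y) (c c' : word y x) (s : form1 b b') (t : form1 c c') :
    tform2 (t_comp (t_tr (f_box t s)) (t_phi b c))
           (t_comp (t_phi b' c') (t_tr (f_box s t)))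
| d_phi' x y (b b' : word x y) (c c' : word y x) (s : form1 b b') (t : form1 c c') :
    tform2 (t_comp (t_phi b' c') (t_tr (f_box s t)))
           (t_comp (t_tr (f_box t s)) (t_phi b c))
| d_m x y z (f3 : word z x) (f2 : word y z) (f1 : word x y) :
    tform2
      (t_comp (t_comp (t_comp (t_tr (f_aV f2 f1 f3)) (t_phi (w_box f1 f3) f2))
                      (t_tr (f_aV f1 f3 f2)))
              (t_phi (w_box f3 f2) f1))
      (t_comp (t_phi f3 (w_box f2 f1)) (t_tr (f_a f3 f2 f1)))
| d_m' x y z (f3 : word z x) (f2 : word y z) (f1 : word x y) :
    tform2
      (t_comp (t_phi f3 (w_box f2 f1)) (t_tr (f_a f3 f2 f1)))
      (t_comp (t_comp (t_comp (t_tr (f_aV f2 f1 f3)) (t_phi (w_box f1 f3) f2))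
                      (t_tr (f_aV f1 f3 f2)))
              (t_phi (w_box f3 f2) f1))
| d_kappa x (f : word x x) :
    tform2 (t_comp (t_comp (t_tr (f_r f)) (t_phi (w_one x) f)) (t_tr (f_lV f)))
           (t_id (Loop f))
| d_kappa' x (f : word x x) :
    tform2 (t_id (Loop f))
           (t_comp (t_comp (t_tr (f_r f)) (t_phi (w_one x) f)) (t_tr (f_lV f))).

(** ** The relations

   For any candidate relations [R] and [RB] on formal 2-cells, the formal cells
   form the operations of a tricategory with a 3-trace. *)
Section FormalStructure.
Variable R : forall (x y : V) (b c : word x y) (s t : form1 b c),
  form2 s t -> form2 s t -> Prop.
Variable RB : forall (v w : loop) (s t : tform1 v w),
  tform2 s t -> tform2 s t -> Prop.

Definition formHom (x y : V) : BicatData := {|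
  ob := word x y; hom1 := @form1 x y; hom2 := @form2 x y; eq2 := @R x y;
  id1 := @f_id x y; comp1 := fun b c d t s => f_comp t s;
  id2 := @c_id x y; vcomp := fun b c s t u β α => c_vcomp β α;
  hcomp := fun b c d t t' s s' β α => c_hcomp β α;
  lun := @c_lun x y; lunV := @c_lunV x y;
  run := @c_run x y; runV := @c_runV x y;
  asc := @c_asc x y; ascV := @c_ascV x y |}.

Definition formBx (x y z : V) :
  PFunData (prodB (formHom y z) (formHom x y)) (formHom x z) := {|
  rmap := @MkRMap (prodB (formHom y z) (formHom x y)) (formHom x z)
    (fun p => w_box (pfst p) (psnd p)) (fun p q s => f_box (pfst s) (psnd s));
  map2 := fun p q s t α => c_box (pfst α) (psnd α);
  mcomp := fun p q r t s => c_box_comp (pfst t) (psnd t) (pfst s) (psnd s);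
  mcompV := fun p q r t s => c_box_compV (pfst t) (psnd t) (pfst s) (psnd s);
  mid := fun p => c_box_id (pfst p) (psnd p);
  midV := fun p => c_box_idV (pfst p) (psnd p) |}.

Definition formUn (x : V) : PFunData oneB (formHom x x) := {|
  rmap := @MkRMap oneB (formHom x x) (fun _ => w_one x) (fun _ _ _ => f_un x);
  map2 := fun _ _ _ _ _ => c_un x;
  mcomp := fun _ _ _ _ _ => c_un_comp x;
  mcompV := fun _ _ _ _ _ => c_un_compV x;
  mid := fun _ => c_un_id x;
  midV := fun _ => c_un_idV x |}.

Definition formBase : TriBase := MkTriBase formBx formUn.

Definition formAU : TriAssocUnit formBase := {|
  ta := fun x y z w : formBase => MkTrans
    (fun q => f_a (pfst q) (pfst (psnd q)) (psnd (psnd q)))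
    (fun q q' s => c_a (pfst s) (pfst (psnd s)) (psnd (psnd s)))
    (fun q q' s => c_a' (pfst s) (pfst (psnd s)) (psnd (psnd s)));
  ta_adj := fun x y z w : formBase => MkAdjEq
    (MkTrans
      (fun q => f_aV (pfst q) (pfst (psnd q)) (psnd (psnd q)))
      (fun q q' s => c_aV (pfst s) (pfst (psnd s)) (psnd (psnd s)))
      (fun q q' s => c_aV' (pfst s) (pfst (psnd s)) (psnd (psnd s))))
    (MkMod (fun q => c_aη (pfst q) (pfst (psnd q)) (psnd (psnd q)))
           (fun q => c_aη' (pfst q) (pfst (psnd q)) (psnd (psnd q))))
    (MkMod (fun q => c_aε (pfst q) (pfst (psnd q)) (psnd (psnd q)))
           (fun q => c_aε' (pfst q) (pfst (psnd q)) (psnd (psnd q))));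
  tlu := fun x y : formBase => MkTrans (@f_l x y) (@c_l x y) (@c_l' x y);
  tlu_adj := fun x y : formBase => MkAdjEq
    (MkTrans (@f_lV x y) (@c_lV x y) (@c_lV' x y))
    (MkMod (@c_lη x y) (@c_lη' x y)) (MkMod (@c_lε x y) (@c_lε' x y));
  tru := fun x y : formBase => MkTrans (@f_r x y) (@c_r x y) (@c_r' x y);
  tru_adj := fun x y : formBase => MkAdjEq
    (MkTrans (@f_rV x y) (@c_rV x y) (@c_rV' x y))
    (MkMod (@c_rη x y) (@c_rη' x y)) (MkMod (@c_rε x y) (@c_rε' x y))
|}.

Definition formTri : TriData := {|
  tri_base := formBase;
  tri_au := formAU;
  tri_pi := fun v w x y z : formBase => MkMod
    (fun q => c_pi (pfst q) (pfst (psnd q)) (pfst (psnd (psnd q)))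
                   (psnd (psnd (psnd q))))
    (fun q => c_pi' (pfst q) (pfst (psnd q)) (pfst (psnd (psnd q)))
                    (psnd (psnd (psnd q))));
  tri_mu := fun x y z : formBase => MkMod
    (fun q => c_mu (pfst q) (psnd q)) (fun q => c_mu' (pfst q) (psnd q));
  tri_lam := fun x y z : formBase => MkMod
    (fun q => c_lam (pfst q) (psnd q)) (fun q => c_lam' (pfst q) (psnd q));
  tri_rho := fun x y z : formBase => MkMod
    (fun q => c_rho (pfst q) (psnd q)) (fun q => c_rho' (pfst q) (psnd q))
|}.

Definition formB : BicatData := {|
  ob := loop; hom1 := tform1; hom2 := @tform2; eq2 := @RB;
  id1 := t_id; comp1 := fun u v w t s => t_comp t s;
  id2 := @d_id; vcomp := fun v w s t u β α => d_vcomp β α;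
  hcomp := fun u v w t t' s s' β α => d_hcomp β α;
  lun := @d_lun; lunV := @d_lunV; run := @d_run; runV := @d_runV;
  asc := @d_asc; ascV := @d_ascV |}.

Definition formTrF (x : V) : PFunData (formHom x x) formB := {|
  rmap := @MkRMap (formHom x x) formB (fun b => Loop b) (fun b c s => t_tr s);
  map2 := fun b c s t α => d_tr α;
  mcomp := fun b c d t s => d_tr_comp t s;
  mcompV := fun b c d t s => d_tr_compV t s;
  mid := fun b => d_tr_id b;
  midV := fun b => d_tr_idV b |}.

Definition formPhi : TracePhi formTri formB := {|
  trF := formTrF : forall x : formTri, PFunData (Hom x x) formB;
  phiT := fun x y : formBase => MkTrans
    (fun q => t_phi (pfst q) (psnd q))
    (fun q q' s => d_phi (pfst s) (psnd s))
    (fun q q' s => d_phi' (pfst s) (psnd s)) |}.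

Definition formTrace : TraceData formTri formB := {|
  tr_phi := formPhi;
  tr_m := fun x y z : formBase => MkMod
    (fun q => d_m (pfst q) (pfst (psnd q)) (psnd (psnd q)))
    (fun q => d_m' (pfst q) (pfst (psnd q)) (psnd (psnd q)));
  tr_kappa := fun x : formBase => MkMod (@d_kappa x) (@d_kappa' x)
|}.

Definition form_laws : Prop :=
  [/\ TriLaws formTri, BicatLaws formB & TraceLaws formTrace].
End FormalStructure.

(** The equivalences induced by the axioms of a tricategory and of a 3-trace:
   the smallest relations for which these axioms hold for formal cells. *)
Definition form2_eq (x y : V) (b c : word x y) (s t : form1 b c)
    (α β : form2 s t) : Prop :=
  forall R RB, form_laws R RB -> R x y b c s t α β.

Definition tform2_eq (v w : loop) (s t : tform1 v w) (α β : tform2 s t) : Prop :=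
  forall R RB, form_laws R RB -> RB v w s t α β.

Definition formTriQ : TriData := formTri form2_eq.
Definition formBQ : BicatData := formB tform2_eq.

(** ** 1-cells of the formal 2-graph

   a, l, r and their inverses, applied to subwords of a word. *)
Inductive subcell : forall x y : V, word x y -> word x y -> Type :=
| s_a x y z w (b : word z w) (c : word y z) (d : word x y) :
    subcell (w_box (w_box b c) d) (w_box b (w_box c d))
| s_aV x y z w (b : word z w) (c : word y z) (d : word x y) :
    subcell (w_box b (w_box c d)) (w_box (w_box b c) d)
| s_l x y (b : word x y) : subcell (w_box (w_one y) b) b
| s_lV x y (b : word x y) : subcell b (w_box (w_one y) b)
| s_r x y (b : word x y) : subcell (w_box b (w_one x)) b
| s_rV x y (b : word x y) : subcell b (w_box b (w_one x))
| s_left x y z (b b' : word y z) (c : word x y) :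
    subcell b b' -> subcell (w_box b c) (w_box b' c)
| s_right x y z (b : word y z) (c c' : word x y) :
    subcell c c' -> subcell (w_box b c) (w_box b c').

Inductive cell : loop -> loop -> Type :=
| cell_sub x (b c : word x x) : subcell b c -> cell (Loop b) (Loop c)
| cell_phi x y (b : word x y) (c : word y x) :
    cell (Loop (w_box b c)) (Loop (w_box c b)).

Fixpoint subcell1 (x y : V) (b c : word x y) (s : subcell b c) : form1 b c :=
  match s with
  | s_a _ _ _ _ b c d => f_a b c d
  | s_aV _ _ _ _ b c d => f_aV b c d
  | s_l _ _ b => f_l b
  | s_lV _ _ b => f_lV b
  | s_r _ _ b => f_r b
  | s_rV _ _ b => f_rV b
  | s_left _ _ _ _ _ c s => f_box (subcell1 s) (f_id c)
  | s_right _ _ _ b _ _ s => f_box (f_id b) (subcell1 s)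
  end.

Definition cell1 (v w : loop) (s : cell v w) : tform1 v w :=
  match s with
  | cell_sub _ _ _ s => t_tr (subcell1 s)
  | cell_phi _ _ b c => t_phi b c
  end.

End Formal.
Arguments word {V} gen _ _.
Arguments loop {V} gen.

Section Evaluation.
Context {T : TriData} {B : BicatData} (P : TraceData T B).
Context {V : Type} {gen : V -> V -> Type}.
Variable o : V -> T.
Variable e : forall x y : V, gen x y -> Hom (o x) (o y).

Fixpoint evw (x y : V) (b : word gen x y) : Hom (o x) (o y) :=
  match b in word _ x y return Hom (o x) (o y) with
  | w_gen _ _ f => e f
  | w_one x => one (o x)
  | w_box _ _ _ b c => evw b □ evw c
  end.

Fixpoint ev1 (x y : V) (b c : word gen x y) (s : form1 b c) :
  hom1 (evw b) (evw c) :=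
  match s in @form1 _ _ x y b c return hom1 (evw b) (evw c) with
  | f_id _ _ b => id1 (evw b)
  | f_comp _ _ _ _ _ t s => ev1 t ∘ ev1 s
  | f_box _ _ _ _ _ _ _ s t => ev1 s ⊠ ev1 t
  | f_un x => r1 (un (o x)) (tt : @hom1 oneB tt tt)
  | f_a _ _ _ _ b c d => a_ (evw b) (evw c) (evw d)
  | f_aV _ _ _ _ b c d => aV_ (evw b) (evw c) (evw d)
  | f_l _ _ b => l_ (evw b)
  | f_lV _ _ b => lV_ (evw b)
  | f_r _ _ b => r_ (evw b)
  | f_rV _ _ b => rV_ (evw b)
  end.

Notation tl := (tlu (tri_au T)).
Notation tlV := (adjV (tlu_adj (tri_au T))).
Notation tr := (tru (tri_au T)).
Notation trV := (adjV (tru_adj (tri_au T))).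
Notation taV := (adjV (ta_adj (tri_au T))).
Notation arg2 g f :=
  (⟨evw g, evw f⟩ : prodB (Hom _ _) (Hom _ _)).
Notation arg3 b c d :=
  (⟨evw b, ⟨evw c, evw d⟩⟩ : prodB (Hom _ _) (prodB (Hom _ _) (Hom _ _))).
Notation arg3_1 u t s :=
  (⟨ev1 u, ⟨ev1 t, ev1 s⟩⟩ :
    @hom1 (prodB (Hom _ _) (prodB (Hom _ _) (Hom _ _)))
      ⟨_, ⟨_, _⟩⟩ ⟨_, ⟨_, _⟩⟩).
Notation arg2_1 t s :=
  (⟨ev1 t, ev1 s⟩ : @hom1 (prodB (Hom _ _) (Hom _ _)) ⟨_, _⟩ ⟨_, _⟩).
Notation u1 := (tt : @hom1 oneB tt tt).

Fixpoint ev2 (x y : V) (b c : word gen x y) (s t : form1 b c) (α : form2 s t) :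
  hom2 (ev1 s) (ev1 t) :=
  match α in @form2 _ _ x y b c s t return hom2 (ev1 s) (ev1 t) with
  | c_id _ _ _ _ s => id2 (ev1 s)
  | c_vcomp _ _ _ _ _ _ _ β α => ev2 β • ev2 α
  | c_hcomp _ _ _ _ _ _ _ _ _ β α => ev2 β ∗ ev2 α
  | c_lun _ _ _ _ s => lun (ev1 s)
  | c_lunV _ _ _ _ s => lunV (ev1 s)
  | c_run _ _ _ _ s => run (ev1 s)
  | c_runV _ _ _ _ s => runV (ev1 s)
  | c_asc _ _ _ _ _ _ u t s => asc (ev1 u) (ev1 t) (ev1 s)
  | c_ascV _ _ _ _ _ _ u t s => ascV (ev1 u) (ev1 t) (ev1 s)
  | c_box _ _ _ _ _ _ _ _ _ _ _ α β => box2 (ev2 α) (ev2 β)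
  | c_box_comp _ _ _ _ _ _ _ _ _ s' t' s t =>
      mcomp bx (arg2_1 s' t') (arg2_1 s t)
  | c_box_compV _ _ _ _ _ _ _ _ _ s' t' s t =>
      mcompV bx (arg2_1 s' t') (arg2_1 s t)
  | c_box_id _ _ _ b c => mid bx (arg2 b c)
  | c_box_idV _ _ _ b c => midV bx (arg2 b c)
  | c_un x => map2 (un (o x)) (tt : @hom2 oneB tt tt tt tt)
  | c_un_comp x => mcomp (un (o x)) u1 u1
  | c_un_compV x => mcompV (un (o x)) u1 u1
  | c_un_id x => mid (un (o x)) (tt : oneB)
  | c_un_idV x => midV (un (o x)) (tt : oneB)
  | c_a _ _ _ _ _ _ _ _ _ _ u t s => tn (ta (tri_au T)) (arg3_1 u t s)
  | c_a' _ _ _ _ _ _ _ _ _ _ u t s => tnV (ta (tri_au T)) (arg3_1 u t s)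
  | c_aV _ _ _ _ _ _ _ _ _ _ u t s => tn taV (arg3_1 u t s)
  | c_aV' _ _ _ _ _ _ _ _ _ _ u t s => tnV taV (arg3_1 u t s)
  | c_l _ _ _ _ s => tn tl (ev1 s)
  | c_l' _ _ _ _ s => tnV tl (ev1 s)
  | c_lV _ _ _ _ s => tn tlV (ev1 s)
  | c_lV' _ _ _ _ s => tnV tlV (ev1 s)
  | c_r _ _ _ _ s => tn tr (ev1 s)
  | c_r' _ _ _ _ s => tnV tr (ev1 s)
  | c_rV _ _ _ _ s => tn trV (ev1 s)
  | c_rV' _ _ _ _ s => tnV trV (ev1 s)
  | c_aη _ _ _ _ b c d => mc (aunit (ta_adj (tri_au T))) (arg3 b c d)
  | c_aη' _ _ _ _ b c d => mcV (aunit (ta_adj (tri_au T))) (arg3 b c d)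
  | c_aε _ _ _ _ b c d => mc (acounit (ta_adj (tri_au T))) (arg3 b c d)
  | c_aε' _ _ _ _ b c d => mcV (acounit (ta_adj (tri_au T))) (arg3 b c d)
  | c_lη _ _ b => mc (aunit (tlu_adj (tri_au T))) (evw b)
  | c_lη' _ _ b => mcV (aunit (tlu_adj (tri_au T))) (evw b)
  | c_lε _ _ b => mc (acounit (tlu_adj (tri_au T))) (evw b)
  | c_lε' _ _ b => mcV (acounit (tlu_adj (tri_au T))) (evw b)
  | c_rη _ _ b => mc (aunit (tru_adj (tri_au T))) (evw b)
  | c_rη' _ _ b => mcV (aunit (tru_adj (tri_au T))) (evw b)
  | c_rε _ _ b => mc (acounit (tru_adj (tri_au T))) (evw b)
  | c_rε' _ _ b => mcV (acounit (tru_adj (tri_au T))) (evw b)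
  | c_pi _ _ _ _ _ k h g f => pi_ (evw k) (evw h) (evw g) (evw f)
  | c_pi' _ _ _ _ _ k h g f => piV_ (evw k) (evw h) (evw g) (evw f)
  | c_mu _ _ _ g f => mc tri_mu (arg2 g f)
  | c_mu' _ _ _ g f => mcV tri_mu (arg2 g f)
  | c_lam _ _ _ g f => mc tri_lam (arg2 g f)
  | c_lam' _ _ _ g f => mcV tri_lam (arg2 g f)
  | c_rho _ _ _ g f => mc tri_rho (arg2 g f)
  | c_rho' _ _ _ g f => mcV tri_rho (arg2 g f)
  end.

Definition evl (v : loop gen) : B := trF P (o (cut v)) (evw (lword v)).

Fixpoint evt1 (v w : loop gen) (s : tform1 v w) : hom1 (evl v) (evl w) :=
  match s in tform1 v w return hom1 (evl v) (evl w) with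
  | t_id v => id1 (evl v)
  | t_comp _ _ _ t s => evt1 t ∘ evt1 s
  | t_tr _ _ _ s => tr1 P (ev1 s)
  | t_phi _ _ b c => phi_ P (evw b) (evw c)
  end.

Fixpoint evt2 (v w : loop gen) (s t : tform1 v w) (α : tform2 s t) :
  hom2 (evt1 s) (evt1 t) :=
  match α in @tform2 _ _ v w s t return hom2 (evt1 s) (evt1 t) with
  | d_id _ _ s => id2 (evt1 s)
  | d_vcomp _ _ _ _ _ β α => evt2 β • evt2 α
  | d_hcomp _ _ _ _ _ _ _ β α => evt2 β ∗ evt2 α
  | d_lun _ _ s => lun (evt1 s)
  | d_lunV _ _ s => lunV (evt1 s)
  | d_run _ _ s => run (evt1 s)
  | d_runV _ _ s => runV (evt1 s)
  | d_asc _ _ _ _ u t s => asc (evt1 u) (evt1 t) (evt1 s)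
  | d_ascV _ _ _ _ u t s => ascV (evt1 u) (evt1 t) (evt1 s)
  | d_tr x _ _ _ _ α => map2 (trF P (o x)) (ev2 α)
  | d_tr_comp x _ _ _ t s => mcomp (trF P (o x)) (ev1 t) (ev1 s)
  | d_tr_compV x _ _ _ t s => mcompV (trF P (o x)) (ev1 t) (ev1 s)
  | d_tr_id x b => mid (trF P (o x)) (evw b)
  | d_tr_idV x b => midV (trF P (o x)) (evw b)
  | d_phi _ _ _ _ _ _ s t => phi_nat P (ev1 s) (ev1 t)
  | d_phi' _ _ _ _ _ _ s t => phi_natV P (ev1 s) (ev1 t)
  | d_m _ _ _ f3 f2 f1 => m_ P (evw f3) (evw f2) (evw f1)
  | d_m' _ _ _ f3 f2 f1 => mV_ P (evw f3) (evw f2) (evw f1)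
  | d_kappa _ f => mc (tr_kappa P) (evw f)
  | d_kappa' _ f => mcV (tr_kappa P) (evw f)
  end.

Definition evF : PFunData (formBQ (gen := gen)) B := {|
  rmap := @MkRMap formBQ B evl evt1;
  map2 := evt2;
  mcomp := fun u v w t s => id2 (evt1 t ∘ evt1 s);
  mcompV := fun u v w t s => id2 (evt1 t ∘ evt1 s);
  mid := fun v => id2 (id1 (evl v));
  midV := fun v => id2 (id1 (evl v)) |}.

End Evaluation.

(** * Bicategories of strings

   [strB C i d]: objects are indexed by [W], 1-morphisms are strings of cells
   of the graph [E], composition is concatenation, and the 2-morphisms between
   two strings are those between their values in the bicategory [C]. *)
Section StringBicat.
Context {C : BicatData} {W : Type} {E : W -> W -> Type}.
Variable i : W -> C.
Variable d : forall v w : W, E v w -> hom1 (i v) (i w).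

Definition strval (v w : W) (p : chain E v w) : hom1 (i v) (i w) :=
  cev (cmap (i := i) (D := @hom1 C) d p).

Fixpoint strval_app (u v w : W) (p : chain E u v) :
  forall q : chain E v w, hom2 (strval (capp p q)) (strval q ∘ strval p) :=
  match p as p in chain _ u v
    return forall q : chain E v w, hom2 (strval (capp p q)) (strval q ∘ strval p) with
  | cnil _ => fun q => runV (strval q)
  | ccons _ _ _ f p' => fun q =>
      (id2 (strval q) ∗ cev_consV (d f) (cmap d p'))
        • asc (strval q) (strval p') (d f) • (strval_app p' q ∗ id2 (d f))
        • cev_cons (d f) (cmap d (capp p' q))
  end.

Fixpoint strval_appV (u v w : W) (p : chain E u v) :
  forall q : chain E v w, hom2 (strval q ∘ strval p) (strval (capp p q)) :=
  match p as p in chain _ u v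
    return forall q : chain E v w, hom2 (strval q ∘ strval p) (strval (capp p q)) with
  | cnil _ => fun q => run (strval q)
  | ccons _ _ _ f p' => fun q =>
      cev_consV (d f) (cmap d (capp p' q)) • (strval_appV p' q ∗ id2 (d f))
        • ascV (strval q) (strval p') (d f)
        • (id2 (strval q) ∗ cev_cons (d f) (cmap d p'))
  end.

Definition strB : BicatData := {|
  ob := W; hom1 := chain E; hom2 := fun v w p q => hom2 (strval p) (strval q);
  eq2 := fun v w p q α β => α ≈ β;
  id1 := @cnil W E; comp1 := fun u v w q p => capp p q;
  id2 := fun v w p => id2 (strval p);
  vcomp := fun v w p q r β α => β • α;
  hcomp := fun u v w q q' p p' β α =>
    strval_appV p' q' • (β ∗ α) • strval_app p q;
  lun := fun v w p => lun (strval p) • strval_app p (cnil w);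
  lunV := fun v w p => strval_appV p (cnil w) • lunV (strval p);
  run := fun v w p => run (strval p) • strval_app (cnil v) p;
  runV := fun v w p => strval_appV (cnil v) p • runV (strval p);
  asc := fun u v w x r q p =>
    strval_appV (capp p q) r • (id2 (strval r) ∗ strval_appV p q)
      • asc (strval r) (strval q) (strval p)
      • (strval_app q r ∗ id2 (strval p)) • strval_app p (capp q r);
  ascV := fun u v w x r q p =>
    strval_appV p (capp q r) • (strval_appV q r ∗ id2 (strval p))
      • ascV (strval r) (strval q) (strval p)
      • (id2 (strval r) ∗ strval_app p q) • strval_app (capp p q) r |}.

Definition strF : PFunData strB C := {|
  rmap := @MkRMap strB C i strval;
  map2 := fun v w p q α => α;
  mcomp := fun u v w q p => strval_appV p q;
  mcompV := fun u v w q p => strval_app p q;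
  mid := fun v => id2 (id1 (i v));
  midV := fun v => id2 (id1 (i v)) |}.
End StringBicat.
Arguments strB {C W E} i d.
Arguments strF {C W E} i d.

(** [cmor i] is f_(i+1), from [cob i] to [cob (ordS i)], where [ordS] is the
   successor modulo [n]. *)

Record cstring (T : TriBase) (n : nat) := CString {
  cob : 'I_n -> T;
  cmor : forall i : 'I_n, Hom (cob i) (cob (ordS i))
}.
Arguments CString {T n} cob cmor.
Arguments cob {T n} _ i.
Arguments cmor {T n} _ i.

(** (f_1, ..., f_n) becomes (f_2, ..., f_n, f_1). *)
Definition rot1 (T : TriBase) (n : nat) (f : cstring T n) : cstring T n :=
  CString (fun i => cob f (ordS i)) (fun i => cmor f (ordS i)).

Definition shift (T : TriBase) (n k : nat) (f : cstring T n) : cstring T n :=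
  iter k (@rot1 T n) f.

Inductive letter (n : nat) : 'I_n -> 'I_n -> Type :=
| Letter i : letter i (ordS i).
Arguments Letter {n} i.

(** A bracketed word with [n] placeholders and a cut point [i] is the same as a
   word in the letters i -> i+1 of length [n] from [i] to [i]: its letters are,
   from right to left, i, i+1, ..., i-1. *)
Record vertex (n : nat) := Vertex {
  vloop :> loop (@letter n);
  vlen : wlen (lword vloop) = n
}.

Definition bicatX (n : nat) : BicatData :=
  strB (C := formBQ (gen := @letter n)) (@vloop n)
    (fun v w (s : cell v w) => cell1 s).

Definition cletter (T : TriBase) (n : nat) (f : cstring T n) (i j : 'I_n)
    (s : letter i j) : Hom (cob f i) (cob f j) :=
  match s with Letter i => cmor f i end.

Definition evalE (T : TriData) (B : BicatData) (P : TraceData T B) (n : nat)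
    (f : cstring T n) : PFunData (bicatX n) B :=
  compF (evF P (cletter f)) (strF (C := formBQ) _ _).

Definition equivalent (B : BicatData) (x y : B) : Prop :=
  exists (f : hom1 x y) (g : hom1 y x)
    (η : hom2 (id1 x) (g ∘ f)) (ηV : hom2 (g ∘ f) (id1 x))
    (ε : hom2 (f ∘ g) (id1 y)) (εV : hom2 (id1 y) (f ∘ g)),
    inverse2 η ηV /\ inverse2 ε εV.

(** Categories, functors and equivalences, with morphisms compared by an
   equivalence relation. *)
Record CatData := MkCat {
  cobj :> Type;
  carr : cobj -> cobj -> Type;
  ceq : forall x y : cobj, carr x y -> carr x y -> Prop;
  cid : forall x : cobj, carr x x;
  ccomp : forall x y z : cobj, carr y z -> carr x y -> carr x z
}.
Arguments carr {c} x y.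
Arguments ceq {c x y} _ _.
Arguments cid {c} x.
Arguments ccomp {c x y z} _ _.

Record Functor (C D : CatData) := MkFunctor {
  fob :> C -> D;
  farr : forall x y : C, carr x y -> carr (fob x) (fob y);
  farr_eq : forall (x y : C) (a b : carr x y), ceq a b -> ceq (farr a) (farr b);
  farr_id : forall x : C, ceq (farr (cid x)) (cid (fob x));
  farr_comp : forall (x y z : C) (b : carr y z) (a : carr x y),
    ceq (farr (ccomp b a)) (ccomp (farr b) (farr a))
}.
Arguments farr {C D} _ {x y} _.

Definition equivalence_of_categories (C D : CatData) (F : Functor C D) : Prop :=
  exists G : Functor D C,
    (exists (η : forall x : C, carr x (G (F x))) (ηV : forall x : C, carr (G (F x)) x),
       (forall x : C, ceq (ccomp (ηV x) (η x)) (cid x) /\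
                      ceq (ccomp (η x) (ηV x)) (cid (G (F x)))) /\
       (forall (x y : C) (a : carr x y),
          ceq (ccomp (farr G (farr F a)) (η x)) (ccomp (η y) a))) /\
    (exists (ε : forall y : D, carr (F (G y)) y) (εV : forall y : D, carr y (F (G y))),
       (forall y : D, ceq (ccomp (εV y) (ε y)) (cid (F (G y))) /\
                      ceq (ccomp (ε y) (εV y)) (cid y)) /\
       (forall (x y : D) (a : carr x y),
          ceq (ccomp a (ε x)) (ccomp (ε y) (farr F (farr G a))))).

Definition homCat (B : BicatData) (b c : B) : CatData := {|
  cobj := hom1 b c; carr := fun f g => hom2 f g; ceq := fun f g α β => α ≈ β;
  cid := fun f => id2 f; ccomp := fun f g h β α => β • α |}.

Section Cones.
Context {A : BicatData} {B : Bicat} (E : PFunData A B).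

(** 1-morphisms of [A, B] from the constant 2-functor at [b] to [E]. *)
Record Cone (b : B) := MkCone {
  ctrans :> TransData (constF A b) E;
  ctrans_laws : @TransLaws A B (constF A b) E ctrans
}.

Record ConeMap (b : B) (c c' : Cone b) := MkConeMap {
  cmod :> forall x : A, hom2 (tc c x) (tc c' x);
  cmod_mod : is_modification cmod
}.

Lemma cone_id_mod (b : B) (c : Cone b) :
  is_modification (σ := c) (τ := c) (fun x => id2 (tc c x)).
Proof.
move=> x y f; have L := bicat_laws B.
have := @hcomp_id _ L _ _ _ (r1 E f) (tc c x).
have := @hcomp_id _ L _ _ _ (tc c y) (r1 (constF A b) f).
have Q := eq2_equiv L.
move=> h1 h2.
transitivity (tn c f • id2 (r1 E f ∘ tc c x)).
  by apply: (vcomp_eq L) => //; reflexivity.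
transitivity (tn c f); first exact: vcomp1r.
symmetry.
transitivity (id2 (tc c y ∘ r1 (constF A b) f) • tn c f).
  by apply: (vcomp_eq L) => //; reflexivity.
exact: vcomp1l.
Qed.

Lemma cone_comp_mod (b : B) (c c' c'' : Cone b) (β : ConeMap c' c'')
  (α : ConeMap c c') :
  is_modification (σ := c) (τ := c'') (fun x => β x • α x).
Proof.
move=> x y f; have L := bicat_laws B.
have Q := eq2_equiv L.
have hα := @cmod_mod _ _ _ α x y f; have hβ := @cmod_mod _ _ _ β x y f.
transitivity (tn c'' f • ((id2 (r1 E f) ∗ β x) • (id2 (r1 E f) ∗ α x))).
  apply: (vcomp_eq L); first by reflexivity.
  transitivity ((id2 (r1 E f) • id2 (r1 E f)) ∗ (β x • α x)).
    by apply: (hcomp_eq L); [symmetry; exact: vcomp1l | reflexivity].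
  exact: hcomp_vcomp.
transitivity ((tn c'' f • (id2 (r1 E f) ∗ β x)) • (id2 (r1 E f) ∗ α x)).
  by symmetry; exact: vcompA.
transitivity (((β y ∗ id2 (r1 (constF A b) f)) • tn c' f) • (id2 (r1 E f) ∗ α x)).
  by apply: (vcomp_eq L); [exact: hβ | reflexivity].
transitivity ((β y ∗ id2 (r1 (constF A b) f)) • (tn c' f • (id2 (r1 E f) ∗ α x))).
  exact: vcompA.
transitivity ((β y ∗ id2 (r1 (constF A b) f)) •
              ((α y ∗ id2 (r1 (constF A b) f)) • tn c f)).
  by apply: (vcomp_eq L); [reflexivity | exact: hα].
transitivity (((β y ∗ id2 (r1 (constF A b) f)) •
              (α y ∗ id2 (r1 (constF A b) f))) • tn c f).
  by symmetry; exact: vcompA.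
apply: (vcomp_eq L); last by reflexivity.
transitivity ((β y • α y) ∗ (id2 (r1 (constF A b) f) • id2 (r1 (constF A b) f))).
  by symmetry; exact: hcomp_vcomp.
by apply: (hcomp_eq L); [reflexivity | exact: vcomp1l].
Qed.

(** The category [A, B](b, E) of transformations and modifications. *)
Definition coneCat (b : B) : CatData := {|
  cobj := Cone b; carr := @ConeMap b;
  ceq := fun c c' α β => forall x : A, α x ≈ β x;
  cid := fun c => MkConeMap (cone_id_mod c);
  ccomp := fun c c' c'' β α => MkConeMap (cone_comp_mod β α) |}.

Definition constT (b b' : B) (h : hom1 b b') :
  TransData (constF A b) (constF A b') :=
  MkTrans (F := constF A b) (G := constF A b') (fun _ => h)
    (fun _ _ _ => runV h • lun h) (fun _ _ _ => lunV h • run h).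

(** Equivalences of categories B(b, L) -> [A, B](b, E) that form a
   pseudonatural transformation in b: the invertible modification
   [lim_nat h g] compares first applying the equivalence and then precomposing
   with [h] with first precomposing and then applying the equivalence; it is
   natural in [g] and in [h] and compatible with identities and composition. *)
Record TwoLimit (L : B) := MkTwoLimit {
  lim_fun : forall b : B, Functor (homCat b L) (coneCat b);
  lim_equiv : forall b : B, equivalence_of_categories (lim_fun b);
  lim_nat : forall (b b' : B) (h : hom1 b' b) (g : hom1 b L),
    ModData (constT h ⨾ ctrans (lim_fun b g)) (ctrans (lim_fun b' (g ∘ h)));
  lim_nat_laws : forall (b b' : B) (h : hom1 b' b) (g : hom1 b L),
    ModLaws (lim_nat h g);
  lim_nat_l : forall (b b' : B) (h : hom1 b' b) (g g' : hom1 b L)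
    (β : hom2 g g') (x : A),
    mc (lim_nat h g') x • (cmod (farr (lim_fun b) β) x ∗ id2 h)
    ≈ cmod (farr (lim_fun b') (β ∗ id2 h : carr (c := homCat b' L) _ _)) x
        • mc (lim_nat h g) x;
  lim_nat_r : forall (b b' : B) (h h' : hom1 b' b) (χ : hom2 h h')
    (g : hom1 b L) (x : A),
    mc (lim_nat h' g) x • (id2 (ctrans (lim_fun b g) x) ∗ χ)
    ≈ cmod (farr (lim_fun b') (id2 g ∗ χ : carr (c := homCat b' L) _ _)) x
        • mc (lim_nat h g) x;
  lim_nat_id : forall (b : B) (g : hom1 b L) (x : A),
    mc (lim_nat (id1 b) g) x
    ≈ cmod (farr (lim_fun b) (runV g : carr (c := homCat b L) _ _)) x
        • run (ctrans (lim_fun b g) x);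
  lim_nat_comp : forall (b b' b'' : B) (h : hom1 b' b) (k : hom1 b'' b')
    (g : hom1 b L) (x : A),
    cmod (farr (lim_fun b'') (asc g h k : carr (c := homCat b'' L) _ _)) x
      • mc (lim_nat k (g ∘ h)) x • (mc (lim_nat h g) x ∗ id2 k)
    ≈ mc (lim_nat (h ∘ k) g) x • asc (ctrans (lim_fun b g) x) h k
}.

Definition is_2limit (L : B) : Prop := inhabited (TwoLimit L).

End Cones.

(* Main.v *)
Require Import Defs.
From mathcomp Require Import ssreflect ssrbool ssrnat.
From mathcomp Require Import ssrfun eqtype fintype.
From Stdlib Require Import Setoid Morphisms JMeq FunctionalExtensionality.
From Stdlib Require Import ClassicalEpsilon ProofIrrelevance.

(** Increasing all letters by one modulo [n] is an automorphism of the formal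
   2-graph, and evaluating a formal cell on the rotated string is the same as
   evaluating its renaming on the original string, strictly and not only up to
   isomorphism.  Hence the two diagrams are obtained from each other by
   reindexing along mutually inverse maps, which identifies their categories of
   cones over every object, and so their 2-limits.  Any two 2-limits of one
   diagram are equivalent by the Yoneda argument.

   The renaming of words, 1-cells and 2-cells is itself an evaluation, in the
   formal tricategory with its formal 3-trace, so the strict compatibility says
   that evaluating twice is evaluating once; it is an equality between cells
   whose end points are equal only propositionally, hence stated with [JMeq]. *)

Set Implicit Arguments.
Unset Strict Implicit.
Unset Printing Implicit Defensive.
Local Open Scope bicat_scope.

(** * Rewriting modulo the relation on 2-cells *)

#[local] Instance eq2_equivalence (B : Bicat) (x y : B) (f g : hom1 x y) :
  Equivalence (@eq2 B x y f g) := eq2_equiv (bicat_laws B) f g.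

#[local] Instance vcomp_proper (B : Bicat) (x y : B) (f g h : hom1 x y) :
  Proper (eq2 ==> eq2 ==> eq2) (@vcomp B x y f g h).
Proof. move=> β β' e α α'; exact: (vcomp_eq (bicat_laws B)). Qed.
#[local] Instance hcomp_proper (B : Bicat) (x y z : B) (g g' : hom1 y z)
    (f f' : hom1 x y) :
  Proper (eq2 ==> eq2 ==> eq2) (@hcomp B x y z g g' f f').
Proof. move=> β β' e α α'; exact: (hcomp_eq (bicat_laws B)). Qed.

(** * Categories and equivalences *)

Record CatLaws (C : CatData) : Prop := {
  ceq_equiv : forall x y : C, Equivalence (@ceq C x y);
  ccomp_eq : forall (x y z : C) (b b' : carr y z) (a a' : carr x y),
    ceq b b' -> ceq a a' -> ceq (ccomp b a) (ccomp b' a');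
  ccompA : forall (x y z w : C) (c : carr z w) (b : carr y z) (a : carr x y),
    ceq (ccomp (ccomp c b) a) (ccomp c (ccomp b a));
  ccomp1l : forall (x y : C) (a : carr x y), ceq (ccomp (cid y) a) a;
  ccomp1r : forall (x y : C) (a : carr x y), ceq (ccomp a (cid x)) a
}.

Lemma homCat_laws (B : Bicat) (b c : B) : CatLaws (homCat b c).
Proof.
have L := bicat_laws B; split=> /=.
- move=> x y; exact: eq2_equiv.
- move=> x y z b1 b1' a a'; exact: (vcomp_eq L).
- move=> x y z w c' b' a; exact: (vcompA L).
- move=> x y a; exact: (vcomp1l L).
- move=> x y a; exact: (vcomp1r L).
Qed.

Lemma coneCat_laws (A : BicatData) (B : Bicat) (E : PFunData A B) (b : B) :
  CatLaws (coneCat E b).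
Proof.
have L := bicat_laws B; split=> /=.
- move=> x y; split.
  + by move=> a v; reflexivity.
  + by move=> a a' h v; symmetry.
  + by move=> a1 a2 a3 h h' v; rewrite (h v).
- by move=> x y z b1 b1' a a' h h' v; apply: (vcomp_eq L).
- move=> x y z w c' b' a v; exact: (vcompA L).
- move=> x y a v; exact: (vcomp1l L).
- move=> x y a v; exact: (vcomp1r L).
Qed.

Definition faithful (C D : CatData) (F : Functor C D) : Prop :=
  forall (x y : C) (a b : carr x y), ceq (farr F a) (farr F b) -> ceq a b.
Definition full (C D : CatData) (F : Functor C D) : Prop :=
  forall (x y : C) (d : carr (F x) (F y)), exists a : carr x y, ceq (farr F a) d.
Definition iso_arr (C : CatData) (x y : C) (a : carr x y) (b : carr y x) : Prop :=
  ceq (ccomp b a) (cid x) /\ ceq (ccomp a b) (cid y).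
Definition ess_surj (C D : CatData) (F : Functor C D) : Prop :=
  forall y : D, exists (x : C) (a : carr (F x) y) (b : carr y (F x)), iso_arr a b.

Lemma farr_iso (C D : CatData) (F : Functor C D) (LD : CatLaws D) (x y : C)
    (a : carr x y) (b : carr y x) : iso_arr a b -> iso_arr (farr F a) (farr F b).
Proof.
have Q := ceq_equiv LD.
have inv u v (s : carr u v) (t : carr v u) : ceq (ccomp s t) (cid v) ->
    ceq (ccomp (farr F s) (farr F t)) (cid (F v)).
  move=> h; transitivity (farr F (ccomp s t)).
    by symmetry; apply: farr_comp.
  by transitivity (farr F (cid v)); [apply: farr_eq | apply: farr_id].
by move=> [h h']; split; apply: inv.
Qed.

Definition comp_functor (C D E : CatData) (G : Functor D E) (F : Functor C D)
  (LE : CatLaws E) : Functor C E.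
Proof.
refine (@MkFunctor C E (fun x => G (F x)) (fun x y a => farr G (farr F a)) _ _ _).
- by move=> x y a b h; apply/farr_eq/farr_eq.
- move=> x; have Q := ceq_equiv LE.
  by transitivity (farr G (cid (F x))); [apply/farr_eq/farr_id | apply: farr_id].
- move=> x y z b a; have Q := ceq_equiv LE.
  by transitivity (farr G (ccomp (farr F b) (farr F a)));
    [apply/farr_eq/farr_comp | apply: farr_comp].
Defined.

Section Equivalences.
Variables (C D : CatData) (F : Functor C D).
Hypotheses (LC : CatLaws C) (LD : CatLaws D).
#[local] Instance ceqC (x y : C) : Equivalence (@ceq C x y) := ceq_equiv LC x y.
#[local] Instance ceqD (x y : D) : Equivalence (@ceq D x y) := ceq_equiv LD x y.
#[local] Instance ccompC (x y z : C) : Proper (ceq ==> ceq ==> ceq) (@ccomp C x y z).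
Proof. move=> b b' h a a' h'; exact: (ccomp_eq LC). Qed.
#[local] Instance ccompD (x y z : D) : Proper (ceq ==> ceq ==> ceq) (@ccomp D x y z).
Proof. move=> b b' h a a' h'; exact: (ccomp_eq LD). Qed.
#[local] Instance farrF (x y : C) : Proper (ceq ==> ceq) (@farr C D F x y).
Proof. move=> b b' h; exact: farr_eq. Qed.

Lemma equivalence_faithful : equivalence_of_categories F -> faithful F.
Proof.
case=> G [[η [ηV [ηi ηn]]] _] x y a b h.
rewrite -(ccomp1l LC a) -(ccomp1l LC b) -(proj1 (ηi y)) !(ccompA LC) -!ηn.
by apply: (ccomp_eq LC); [reflexivity | apply: (ccomp_eq LC);
  [apply: farr_eq | reflexivity]].
Qed.
Lemma equivalence_ess_surj : equivalence_of_categories F -> ess_surj F.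
Proof. by case=> G [_ [ε [εV [εi _]]]] y; exists (G y), (ε y), (εV y); apply: εi. Qed.

(** The preimage of [d] is [G d] conjugated by the unit of the equivalence. That [F] sends it to [d]
    is tested after applying [G], which is faithful because of the counit. *)
Lemma equivalence_full : equivalence_of_categories F -> full F.
Proof.
case=> G [[η [ηV [ηi ηn]]] [ε [εV [εi εn]]]] x y d.
exists (ccomp (ηV y) (ccomp (farr G d) (η x))).
have Gf : forall (x y : D) (a b : carr x y), ceq (farr G a) (farr G b) -> ceq a b.
  move=> u v a b h.
  rewrite -(ccomp1r LD a) -(ccomp1r LD b) -(proj2 (εi u)) -!(ccompA LD) !εn.
  apply: (ccomp_eq LD); last reflexivity.
  apply: (ccomp_eq LD); first reflexivity.
  exact: farr_eq.
apply: Gf.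
set a := ccomp _ _.
rewrite -(ccomp1r LC (farr G (farr F a))) -(proj2 (ηi x)) -(ccompA LC) ηn /a.
rewrite -!(ccompA LC) (proj2 (ηi y)) (ccomp1l LC) (ccompA LC) (proj2 (ηi x)).
exact: (ccomp1r LC).
Qed.

Lemma ff_es_equivalence :
  faithful F -> full F -> ess_surj F -> equivalence_of_categories F.
Proof.
move=> Ff Fu Fe.
(* A quasi-inverse consists of functions, so fullness and essential surjectivity are turned into
   choices. The chosen arrows respect [ceq] and composition because [F] is faithful. *)
have {}Fu x y (d : carr (F x) (F y)) : {a : carr x y | ceq (farr F a) d}.
  exact: constructive_indefinite_description.
have {}Fe y : {x : C & {a : carr (F x) y & {b : carr y (F x) | iso_arr a b}}}.
  have [x h] := constructive_indefinite_description _ (Fe y); exists x.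
  have [a h'] := constructive_indefinite_description _ h; exists a.
  exact: constructive_indefinite_description.
pose g y := projT1 (Fe y).
pose ε y : carr (F (g y)) y := projT1 (projT2 (Fe y)).
pose εV y : carr y (F (g y)) := proj1_sig (projT2 (projT2 (Fe y))).
have εi y : iso_arr (ε y) (εV y) := proj2_sig (projT2 (projT2 (Fe y))).
pose garr x y (d : carr x y) : carr (g x) (g y) :=
  proj1_sig (Fu _ _ (ccomp (εV y) (ccomp d (ε x)))).
have gE x y (d : carr x y) : ceq (farr F (garr x y d)) (ccomp (εV y) (ccomp d (ε x))).
  exact: (proj2_sig (Fu _ _ (ccomp (εV y) (ccomp d (ε x))))).
have g1 x y (a b : carr x y) : ceq a b -> ceq (garr _ _ a) (garr _ _ b).
  by move=> h; apply: Ff; rewrite !gE h; reflexivity.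
have g2 x : ceq (garr _ _ (cid x)) (cid (g x)).
  apply: Ff; rewrite gE farr_id (ccomp1l LD); exact: (proj1 (εi x)).
have g3 x y z (b : carr y z) (a : carr x y) :
  ceq (garr _ _ (ccomp b a)) (ccomp (garr _ _ b) (garr _ _ a)).
  apply: Ff; rewrite farr_comp !gE !(ccompA LD).
  rewrite -(ccompA LD _ (εV y)) (proj2 (εi y)) (ccomp1l LD); reflexivity.
exists (MkFunctor g1 g2 g3); split.
(* By fullness, the unit at [x] is a preimage of the inverse counit at [F x]. *)
- pose η x : {a : carr x (g (F x)) | ceq (farr F a) (εV (F x))} := Fu _ _ _.
  pose ηV x : {a : carr (g (F x)) x | ceq (farr F a) (ε (F x))} := Fu _ _ _.
  exists (fun x => proj1_sig (η x)), (fun x => proj1_sig (ηV x)); split=> [x|x y a].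
    split; apply: Ff; rewrite farr_comp (proj2_sig (η x)) (proj2_sig (ηV x)) farr_id.
      exact: (proj2 (εi (F x))).
    exact: (proj1 (εi (F x))).
  apply: Ff; rewrite !farr_comp /= gE (proj2_sig (η x)) (proj2_sig (η y)).
  rewrite !(ccompA LD) (proj2 (εi (F x))) (ccomp1r LD); reflexivity.
- exists ε, εV; split=> // x y a /=.
  by rewrite gE -(ccompA LD) (proj2 (εi y)) (ccomp1l LD); reflexivity.
Qed.
End Equivalences.

Lemma equivalence_comp (C D E : CatData) (G : Functor D E) (F : Functor C D)
    (LC : CatLaws C) (LD : CatLaws D) (LE : CatLaws E) :
  faithful G -> full G -> ess_surj G -> equivalence_of_categories F ->
  equivalence_of_categories (comp_functor G F LE).
Proof.
move=> Gf Gu Ge HF; have QE := ceq_equiv LE.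
have Ff := equivalence_faithful LC HF; have Fu := equivalence_full LC LD HF.
have Fe := equivalence_ess_surj HF.
apply: ff_es_equivalence => //.
- by move=> x y a b /Gf /Ff.
- move=> x y d; have [d' h] := Gu _ _ d; have [a h'] := Fu _ _ d'.
  by exists a; transitivity (farr G d') => //; exact: (@farr_eq _ _ G _ _ _ _ h').
- move=> z; have [y [a [b [h1 h2]]]] := Ge z.
  have [x [a' [b' [h3 h4]]]] := Fe y.
  exists x, (ccomp a (farr G a')), (ccomp (farr G b') b).
  have [h3' h4'] := farr_iso G LE (conj h3 h4).
  have canc (u v w v' : E) (s : carr w v') (t : carr v w) (t' : carr w v)
      (r : carr u w) :
      ceq (ccomp t t') (cid w) ->
      ceq (ccomp (ccomp s t) (ccomp t' r)) (ccomp s r).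
    move=> h; transitivity (ccomp s (ccomp t (ccomp t' r))); first exact: ccompA.
    apply: (ccomp_eq LE); first reflexivity.
    transitivity (ccomp (ccomp t t') r); first by symmetry; apply: ccompA.
    transitivity (ccomp (cid w) r); last exact: ccomp1l.
    by apply: (ccomp_eq LE) => //; reflexivity.
  split.
  + by transitivity (ccomp (farr G b') (farr G a')); first exact: canc.
  + by transitivity (ccomp a b); first exact: canc.
Qed.
(** * Reindexing a diagram *)

Lemma rmap_eq (A C : BicatData) (R R' : RMap A C) :
  (forall x, R x = R' x) ->
  (forall (x y : A) (f : hom1 x y), JMeq (r1 R f) (r1 R' f)) -> R = R'.
Proof.
case: R => r0 r1; case: R' => r0' r1' /= e0 e1.
have e0' : r0 = r0' by apply: functional_extensionality_dep.
subst r0'; congr MkRMap.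
do 3 apply: functional_extensionality_dep => ?; exact: JMeq_eq.
Qed.

Section Pullback.
Context {A A' : BicatData} {B : Bicat}.

(** [E'] is the strict composite of [E] and [S], where [S] on 2-cells is only
   given up to its effect under [E]: an actual map on 2-cells would have to be
   transported along the equality of strings [sp_comp]. *)
Record strict_pullback (S : RMap A' A) (E : PFunData A B)
    (E' : PFunData A' B) : Prop := {
  sp_id : forall x : A', r1 S (id1 x) = id1 (S x);
  sp_comp : forall (x y z : A') (g : hom1 y z) (f : hom1 x y),
    r1 S (g ∘ f) = r1 S g ∘ r1 S f;
  sp_map : rcomp E S = E';
  sp_map2 : forall (x y : A') (f g : hom1 x y) (α : hom2 f g),
    exists α' : hom2 (r1 S f) (r1 S g), JMeq (map2 E α') (map2 E' α);
  sp_mcomp : forall (x y z : A') (g : hom1 y z) (f : hom1 x y),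
    JMeq (mcomp E (r1 S g) (r1 S f)) (mcomp E' g f);
  sp_mid : forall x : A', JMeq (mid E (S x)) (mid E' x)
}.

(** The map underlying [E'] is taken to be [rcomp E S] on the nose, so that
   cones can be whiskered with [S] without transporting them. *)
Section Pull.
Variables (E : PFunData A B) (S : RMap A' A).
Variables (m2 : forall (x y : A') (f g : hom1 x y), hom2 f g ->
    hom2 (r1 (rcomp E S) f) (r1 (rcomp E S) g))
  (kc : forall (x y z : A') (g : hom1 y z) (f : hom1 x y),
    hom2 (r1 (rcomp E S) g ∘ r1 (rcomp E S) f) (r1 (rcomp E S) (g ∘ f)))
  (kcV : forall (x y z : A') (g : hom1 y z) (f : hom1 x y),
    hom2 (r1 (rcomp E S) (g ∘ f)) (r1 (rcomp E S) g ∘ r1 (rcomp E S) f))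
  (mi : forall x : A', hom2 (id1 (rcomp E S x)) (r1 (rcomp E S) (id1 x)))
  (miV : forall x : A', hom2 (r1 (rcomp E S) (id1 x)) (id1 (rcomp E S x))).
Let E' : PFunData A' B := MkPFun m2 kc kcV mi miV.
Hypothesis H : strict_pullback S E E'.

(** Each law is the law of [c] at the image under [S]. In the naturality law, the value of [α] under
    [E'] is replaced by the value under [E] of some 2-cell of [A]. *)
Lemma pull_laws (b : B) (c : Cone E b) :
  @TransLaws A' B (constF A' b) E' (tpre c S).
Proof.
have [cn ci cc cid] := ctrans_laws c.
split=> /=.
- move=> x y f f' α; have [α' h] := sp_map2 H α.
  have <- : map2 E α' = m2 α := JMeq_eq h; exact: cn.
- move=> x y f; exact: ci.
- move=> x y z g f.
  have := cc _ _ _ (r1 S g) (r1 S f).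
  (* The constraint cell of [E'] is generalized first, so that its type can follow the rewriting
     along [sp_comp]; the heterogeneous equality then becomes an ordinary one. *)
  have /= := sp_mcomp H g f; move: (kc g f) => /=.
  rewrite (sp_comp H) => k h; have <- := JMeq_eq h; exact.
- move=> x.
  have := cid (S x).
  have /= := sp_mid H x; move: (mi x) => /=.
  rewrite (sp_id H) => k h; have <- := JMeq_eq h; exact.
Qed.

Definition pull_cone (b : B) (c : Cone E b) : Cone E' b :=
  MkCone (ctrans := (tpre c S : TransData (constF A' b) E')) (pull_laws c).

Lemma pull_mod (b : B) (c c' : Cone E b) (α : ConeMap c c') :
  is_modification (σ := ctrans (pull_cone c)) (τ := ctrans (pull_cone c'))
    (fun x => α (S x)).
Proof. move=> x y f; exact: (cmod_mod α (r1 S f)). Qed.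

Definition pull_functor (b : B) : Functor (coneCat E b) (coneCat E' b).
Proof.
refine (@MkFunctor (coneCat E b) (coneCat E' b) (@pull_cone b)
  (fun c c' α => MkConeMap (pull_mod α)) _ _ _).
- by move=> x y a a' h v; apply: h.
- move=> x v; reflexivity.
- move=> x y z a a' v; reflexivity.
Defined.

Lemma pull_faithful (b : B) : (forall v : A, exists v', S v' = v) ->
  faithful (pull_functor b).
Proof. by move=> hS c c' α β h v; have [v' <-] := hS v; apply: h. Qed.

Lemma pull_full (b : B) :
  (forall v : A, exists v', S v' = v) -> injective S ->
  (forall (x y : A') (f : hom1 (S x) (S y)), exists f', r1 S f' = f) ->
  full (pull_functor b).
Proof.
move=> hS iS h1 c c' γ.
have [α hα] : exists α : forall v : A, hom2 (tc c v) (tc c' v),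
    forall v', α (S v') = γ v'.
  (* The component at [v] is that of [γ] at a chosen preimage of [v], transported to [v]. At [S v']
     the chosen preimage is [v'] by injectivity, and the transport is trivial by proof
     irrelevance. *)
  pose inv v := constructive_indefinite_description _ (hS v).
  exists (fun v => eq_rect (S (proj1_sig (inv v)))
    (fun v => hom2 (tc c v) (tc c' v)) (γ (proj1_sig (inv v))) v (proj2_sig (inv v))).
  move=> v'; case: (inv (S v')) => w /= e.
  have e' := iS _ _ e; move: e; rewrite e' => e.
  by apply: JMeq_eq; rewrite (proof_irrelevance _ e erefl).
have hm : is_modification α.
  move=> x y f; have [x' ex] := hS x; have [y' ey] := hS y; subst x y.
  have [f' <-] := h1 _ _ f; rewrite !hα; exact: (cmod_mod γ f').
exists (MkConeMap hm) => v /=; rewrite hα; reflexivity.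
Qed.
End Pull.

(** Identities serve as components in both directions. The cells [tnV] and the proofs of the laws
    are not compared, which is why the result is an isomorphism of cones and not an equality. *)
Lemma cone_iso (E : PFunData A B) (b : B) (c d : Cone E b) :
  (forall v : A, tc c v = tc d v) ->
  (forall (x y : A) (f : hom1 x y), JMeq (tn c f) (tn d f)) ->
  exists (α : @carr (coneCat E b) c d) (β : @carr (coneCat E b) d c),
    iso_arr α β.
Proof.
case: c => [[c1 c2 c3] lc]; case: d => [[d1 d2 d3] ld] /= e1 e2.
have e : c1 = d1 by apply: functional_extensionality_dep.
subst d1; have L := bicat_laws B.
have hm (k k' : forall (x y : A) (f : hom1 x y),
    hom2 (r1 E f ∘ c1 x) (c1 y ∘ id1 b)) k3 k3' :
  (forall x y (f : hom1 x y), k x y f = k' x y f) ->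
  @is_modification A B (constF A b) E
    (MkTrans (F := constF A b) c1 k k3) (MkTrans (F := constF A b) c1 k' k3')
    (fun x => id2 (c1 x)).
  move=> ek x y f /=; rewrite (hcomp_id L) ek.
  rewrite (hcomp_id L) (vcomp1r L) (vcomp1l L); reflexivity.
have e3 x y (f : hom1 x y) : c2 x y f = d2 x y f := JMeq_eq (e2 x y f).
have m1 := hm _ _ c3 d3 e3.
have m2 := hm _ _ d3 c3 (fun x y f => esym (e3 x y f)).
exists (@MkConeMap _ _ _ _ (MkCone lc) (MkCone ld) _ m1).
exists (@MkConeMap _ _ _ _ (MkCone ld) (MkCone lc) _ m2).
by split=> x /=; apply: (vcomp1l L).
Qed.

Lemma strict_pullback_cone (S : RMap A' A) (E : PFunData A B) (E' : PFunData A' B)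
    (b : B) (c : Cone E b) : strict_pullback S E E' ->
  exists d : Cone E' b, (forall v, JMeq (tc d v) (tc c (S v))) /\
    forall (x y : A') (f : hom1 x y), JMeq (tn d f) (tn c (r1 S f)).
Proof.
case: E' => R' m2 kc kcV mi miV H; have h := sp_map H; simpl in h; subst R'.
by exists (pull_cone H c).
Qed.
End Pullback.

(** Whiskering cones with [S] is full, faithful and essentially surjective, so its composite with
    the equivalences for [E] gives equivalences for [E']. Their pseudonaturality is that for [E],
    read at the objects [S x]. *)
Lemma is_2limit_pullback (A A' : BicatData) (B : Bicat) (E : PFunData A B)
    (E' : PFunData A' B) (S : RMap A' A) (S' : RMap A A') (L : B) :
  strict_pullback S E E' -> strict_pullback S' E' E ->
  rcomp S S' = idF -> rcomp S' S = idF ->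
  is_2limit E L -> is_2limit E' L.
Proof.
move=> H H' K K' [F].
have k v : S (S' v) = v by apply: (congr1 (fun R : RMap A A => R v) K).
have k' v : S' (S v) = v by apply: (congr1 (fun R : RMap A' A' => R v) K').
have hS v : exists v', S v' = v by exists (S' v).
have iS : injective S := can_inj k'.
have h1 (x y : A') (f : hom1 (S x) (S y)) : exists f', r1 S f' = f.
  (* The preimage is [r1 S' f], whose end points are equal to [x] and [y] only propositionally. *)
  have [f' hf] : exists f' : hom1 x y, JMeq f' (r1 S' f).
    have cast u v (g : hom1 u v) : u = x -> v = y -> exists f' : hom1 x y, JMeq f' g.
      by move=> eu ev; subst u v; exists g.
    exact: cast.
  exists f'; apply: JMeq_eq.
  have h : JMeq (r1 S f') (r1 S (r1 S' f)).
    have cast u v (g : hom1 u v) : u = x -> v = y -> JMeq f' g ->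
        JMeq (r1 S f') (r1 S g).
      by move=> eu ev; subst u v => h; rewrite (JMeq_eq h).
    exact: cast.
  have c (R : RMap A A) : R = idF -> JMeq (r1 R f) f by move=> ->.
  exact: JMeq_trans h (c _ K).
(* Essential surjectivity: pulling [c'] back along [S'] and then along [S] returns its components
   and naturality cells, since [rcomp S' S] is the identity. *)
have es (b : B) (c' : Cone E' b) : exists c : Cone E b,
    (forall v, JMeq (tc c (S v)) (tc c' v)) /\
    forall (x y : A') (f : hom1 x y), JMeq (tn c (r1 S f)) (tn c' f).
  have [c [hc0 hc1]] := strict_pullback_cone c' H'; exists c.
  have cg (R : RMap A' A') : R = idF -> (forall v, JMeq (tc c' (R v)) (tc c' v)) /\
     forall (x y : A') (f : hom1 x y), JMeq (tn c' (r1 R f)) (tn c' f) by move=> ->.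
  have [cg0 cg1] := cg _ K'; split=> [v|x y f].
    exact: JMeq_trans (hc0 _) (cg0 _).
  exact: JMeq_trans (hc1 _ _ _) (cg1 _ _ _).
case: E' H H' es => R' m2 kc kcV mi miV H H' es.
have h := sp_map H; simpl in h; subst R'.
have LD b := coneCat_laws E b; have LE b := coneCat_laws (MkPFun m2 kc kcV mi miV) b.
constructor; unshelve eapply (@MkTwoLimit A' B (MkPFun m2 kc kcV mi miV) L
  (fun b => comp_functor (pull_functor H b) (lim_fun F b) (LE b))).
- move=> b b' h g.
  exact (MkMod
    (σ := (constT h ⨾ tpre (ctrans (lim_fun F b g)) S
            : TransData (constF A' b') (rcomp E S)))
    (τ := (tpre (ctrans (lim_fun F b' (g ∘ h))) S
            : TransData (constF A' b') (rcomp E S)))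
    (fun x => mc (lim_nat F h g) (S x)) (fun x => mcV (lim_nat F h g) (S x))).
- move=> b; apply: equivalence_comp (lim_equiv F b) => //.
  + exact: homCat_laws.
  + exact: pull_faithful.
  + exact: pull_full.
  + move=> c'; have [c [c0 c1]] := es b c'; exists c.
    by apply: cone_iso => [v|x y f]; [exact: (JMeq_eq (c0 v)) | exact: c1].
- move=> b b' h g; have [m1 m2'] := lim_nat_laws F h g; split=> [x y f|x].
    exact: (m1 (S x) (S y) (r1 S f)).
  exact: (m2' (S x)).
- move=> b b' h g g' β x; exact: (lim_nat_l F h β (S x)).
- move=> b b' h h' χ g x; exact: (lim_nat_r F χ g (S x)).
- move=> b g x; exact: (lim_nat_id F g (S x)).
- move=> b b' b'' h l g x; exact: (lim_nat_comp F h l g (S x)).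
Qed.

(** * Uniqueness of 2-limits *)

Section Uniqueness.
Context {A : BicatData} {B : Bicat} {E : PFunData A B}.
Let L := bicat_laws B.

Lemma mod_comp (F G : RMap A B) (σ τ υ : TransData F G)
    (Γ : forall x, hom2 (σ x) (τ x)) (Δ : forall x, hom2 (τ x) (υ x)) :
  is_modification Γ -> is_modification Δ -> is_modification (fun x => Δ x • Γ x).
Proof.
move=> hΓ hΔ x y f.
rewrite -[id2 (r1 G f)](vcomp1l L) (hcomp_vcomp L) -(vcompA L) hΔ.
rewrite (vcompA L) hΓ -(vcompA L) -(hcomp_vcomp L) (vcomp1l L); reflexivity.
Qed.

Lemma mod_inv (F G : RMap A B) (σ τ : TransData F G)
    (Γ : forall x, hom2 (σ x) (τ x)) (Γ' : forall x, hom2 (τ x) (σ x)) :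
  is_modification Γ -> (forall x, inverse2 (Γ x) (Γ' x)) -> is_modification Γ'.
Proof.
move=> hΓ hi x y f.
have [i1 _] := hi y; have [_ i2] := hi x.
have j1 : (Γ' y ∗ id2 (r1 F f)) • (Γ y ∗ id2 (r1 F f)) ≈ id2 _.
  rewrite -(hcomp_vcomp L) i1 (vcomp1l L) (hcomp_id L); reflexivity.
have j2 : (id2 (r1 G f) ∗ Γ x) • (id2 (r1 G f) ∗ Γ' x) ≈ id2 _.
  rewrite -(hcomp_vcomp L) i2 (vcomp1l L) (hcomp_id L); reflexivity.
rewrite -[tn τ f](vcomp1r L) -j2 -!(vcompA L) (vcompA L _ (tn τ f)) hΓ.
rewrite -(vcompA L) j1 (vcomp1l L); reflexivity.
Qed.

Lemma ascV_nat (x y z w : B) (h h' : hom1 z w) (g g' : hom1 y z)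
    (f f' : hom1 x y) (γ : hom2 h h') (β : hom2 g g') (α : hom2 f f') :
  ascV h' g' f' • (γ ∗ (β ∗ α)) ≈ ((γ ∗ β) ∗ α) • ascV h g f.
Proof.
have [i1 _] := asc_inv L h' g' f'; have [_ i2] := asc_inv L h g f.
rewrite -[γ ∗ (β ∗ α)](vcomp1r L) -i2 -!(vcompA L).
rewrite (vcompA L _ (γ ∗ _)) -(asc_nat L) -(vcompA L) i1 (vcomp1l L); reflexivity.
Qed.

Lemma vcomp_whisker_r (x y z : B) (g g' g'' : hom1 y z) (h : hom1 x y)
    (β : hom2 g' g'') (α : hom2 g g') :
  (β • α) ∗ id2 h ≈ (β ∗ id2 h) • (α ∗ id2 h).
Proof. rewrite -(hcomp_vcomp L) (vcomp1l L); reflexivity. Qed.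

(** The naturality cell of the composite is pasted from associators, the cell of the cone and the
    unit cell [X] of [constT h]. The modification is moved past each in turn, by naturality, by
    hypothesis and by the interchange law. *)
Lemma mod_whisker (b b' : B) (h : hom1 b' b) (c d : Cone E b)
    (Γ : forall x, hom2 (tc c x) (tc d x)) :
  is_modification Γ ->
  is_modification (σ := constT h ⨾ ctrans c) (τ := constT h ⨾ ctrans d)
    (fun x => Γ x ∗ id2 h).
Proof.
move=> hΓ x y f /=; set X := runV h • lun h.
rewrite !(vcompA L) ascV_nat.
rewrite -(vcompA L (tn d f ∗ _)) -vcomp_whisker_r hΓ vcomp_whisker_r.
rewrite !(vcompA L) -(vcompA L (asc (d y) _ _)) (asc_nat L) !(vcompA L).
rewrite -(vcompA L (id2 (d y) ∗ X)) -(hcomp_vcomp L) (vcomp1l L).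
rewrite (hcomp_id L) (vcomp1r L).
rewrite -(vcompA L _ (ascV (c y) _ _)) -ascV_nat (hcomp_id L) (vcompA L).
rewrite -(vcompA L _ (id2 (c y) ∗ X)) -(hcomp_vcomp L) (vcomp1l L) (vcomp1r L).
reflexivity.
Qed.

(** Stated for bare transformation data, so that it also applies to [constT h ⨾ ctrans c], which is
    not packaged as a cone. *)
Definition mod_iso (F G : RMap A B) (σ τ : TransData F G) : Prop :=
  exists Γ : ModData σ τ, ModLaws Γ.

Lemma mod_iso_sym (F G : RMap A B) (σ τ : TransData F G) :
  mod_iso σ τ -> mod_iso τ σ.
Proof.
case=> Γ [m i]; exists (MkMod (mcV Γ) (mc Γ)); split=> /= [|x].
  exact: (mod_inv m i).
by have [] := i x; split.
Qed.

Lemma mod_iso_trans (F G : RMap A B) (σ τ υ : TransData F G) :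
  mod_iso σ τ -> mod_iso τ υ -> mod_iso σ υ.
Proof.
move=> [Γ [m i]] [Δ [m' i']].
exists (MkMod (fun x => mc Δ x • mc Γ x) (fun x => mcV Γ x • mcV Δ x)).
split=> /= [|x]; first exact: mod_comp.
have [i1 i2] := i x; have [i1' i2'] := i' x; split.
  rewrite (vcompA L) -(vcompA L (mcV Δ x)) i1' (vcomp1l L); exact: i1.
rewrite (vcompA L) -(vcompA L (mc Γ x)) i2 (vcomp1l L); exact: i2'.
Qed.

Lemma mod_iso_whisker (b b' : B) (h : hom1 b' b) (c d : Cone E b) :
  mod_iso (ctrans c) (ctrans d) ->
  mod_iso (constT h ⨾ ctrans c) (constT h ⨾ ctrans d).
Proof.
case=> Γ [m i].
exists (MkMod (σ := constT h ⨾ ctrans c) (τ := constT h ⨾ ctrans d)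
  (fun x => mc Γ x ∗ id2 h) (fun x => mcV Γ x ∗ id2 h)).
split=> /= [|x]; first exact: mod_whisker.
by have [i1 i2] := i x; split; rewrite -vcomp_whisker_r ?i1 ?i2; apply: (hcomp_id L).
Qed.

Lemma iso_arr_mod_iso (b : B) (c d : Cone E b) (α : @carr (coneCat E b) c d)
    (β : @carr (coneCat E b) d c) :
  iso_arr α β -> mod_iso (ctrans c) (ctrans d).
Proof.
move=> [i1 i2]; exists (MkMod (fun x => cmod α x) (fun x => cmod β x)).
split; first exact: cmod_mod.
by move=> x; split; [apply: i1 | apply: i2].
Qed.

Lemma mod_iso_iso_arr (b : B) (c d : Cone E b) :
  mod_iso (ctrans c) (ctrans d) ->
  exists (α : @carr (coneCat E b) c d) (β : @carr (coneCat E b) d c), iso_arr α β.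
Proof.
case=> Γ [m i].
exists (@MkConeMap _ _ _ _ c d _ m).
exists (@MkConeMap _ _ _ _ d c _ (mod_inv m i)).
by split=> x; have [] := i x.
Qed.

(** The Yoneda argument. By pseudonaturality the cone of [v ∘ u] under [F1] is that of [v]
    precomposed with [u], hence that of [id1 L2] under [F2] precomposed with [u], hence that of [u]
    under [F2], hence that of [id1 L1] under [F1], all up to isomorphism. As [F1] is full and
    faithful, this isomorphism comes from one between [v ∘ u] and the identity. *)
Lemma lim_id_comp (L1 L2 : B) (F1 : TwoLimit E L1) (F2 : TwoLimit E L2)
    (u : hom1 L1 L2) (v : hom1 L2 L1) :
  mod_iso (ctrans (lim_fun F2 L1 u)) (ctrans (lim_fun F1 L1 (id1 L1))) ->
  mod_iso (ctrans (lim_fun F1 L2 v)) (ctrans (lim_fun F2 L2 (id1 L2))) ->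
  exists (η : hom2 (id1 L1) (v ∘ u)) (ηV : hom2 (v ∘ u) (id1 L1)), inverse2 η ηV.
Proof.
move=> hu hv.
have hl : mod_iso (ctrans (lim_fun F2 L1 (id1 L2 ∘ u))) (ctrans (lim_fun F2 L1 u)).
  have i : @iso_arr (homCat L1 L2) (id1 L2 ∘ u) u (lun u) (lunV u) := lun_inv L u.
  exact: iso_arr_mod_iso (farr_iso (lim_fun F2 L1) (coneCat_laws E L1) i).
have n1 : mod_iso _ _ := ex_intro _ _ (lim_nat_laws F1 u v).
have n2 : mod_iso _ _ := ex_intro _ _ (lim_nat_laws F2 u (id1 L2)).
have [α [β [i1 i2]]] := mod_iso_iso_arr (mod_iso_trans (mod_iso_sym n1)
  (mod_iso_trans (mod_iso_whisker u hv) (mod_iso_trans n2 (mod_iso_trans hl hu)))).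
have LH := homCat_laws L1 L1; have LC := coneCat_laws E L1.
have fu := equivalence_full LH LC (lim_equiv F1 L1).
have ff := equivalence_faithful LH (lim_equiv F1 L1).
have [ηV hηV] := fu _ _ α; have [η hη] := fu _ _ β.
exists η, ηV; have Q := ceq_equiv LC.
split.
  apply: (ff (id1 L1) (id1 L1)).
  transitivity (ccomp (farr (lim_fun F1 L1) ηV) (farr (lim_fun F1 L1) η)).
    exact: farr_comp.
  transitivity (ccomp α β); first exact: (ccomp_eq LC).
  by transitivity (cid (lim_fun F1 L1 (id1 L1))) => //; symmetry; apply: farr_id.
apply: (ff (v ∘ u) (v ∘ u)).
transitivity (ccomp (farr (lim_fun F1 L1) η) (farr (lim_fun F1 L1) ηV)).
  exact: farr_comp.
transitivity (ccomp β α); first exact: (ccomp_eq LC).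
by transitivity (cid (lim_fun F1 L1 (v ∘ u))) => //; symmetry; apply: farr_id.
Qed.

Lemma is_2limit_unique (L1 L2 : B) :
  is_2limit E L1 -> is_2limit E L2 -> equivalent L1 L2.
Proof.
move=> [F1] [F2].
(* Each comparison morphism represents the universal cone of one limit with respect to the other
   limit. *)
have [u [a [b hu]]] := equivalence_ess_surj (lim_equiv F2 L1) (lim_fun F1 L1 (id1 L1)).
have [v [c [d hv]]] := equivalence_ess_surj (lim_equiv F1 L2) (lim_fun F2 L2 (id1 L2)).
have {}hu := iso_arr_mod_iso hu; have {}hv := iso_arr_mod_iso hv.
have [η [ηV hη]] := lim_id_comp hu hv.
have [εV [ε [h1 h2]]] := lim_id_comp hv hu.
by exists u, v, η, ηV, ε, εV.
Qed.
End Uniqueness.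

(** * Renaming letters *)

(** Endomorphisms of the graph of letters. *)
Record renaming (V : Type) (gen : V -> V -> Type) := Renaming {
  ren :> V -> V;
  renl : forall x y : V, gen x y -> gen (ren x) (ren y)
}.
Arguments renl {V gen} _ {x y} _.

Lemma renaming_eq (V : Type) (gen : V -> V -> Type) (ρ ρ' : renaming gen) :
  (forall x, ren ρ x = ren ρ' x) ->
  (forall x y (s : gen x y), JMeq (renl ρ s) (renl ρ' s)) -> ρ = ρ'.
Proof.
case: ρ => r l; case: ρ' => r' l' /= e0 e1.
have e : r = r' by apply: functional_extensionality_dep.
subst r'; congr Renaming.
do 3 apply: functional_extensionality_dep => ?; exact: JMeq_eq.
Qed.

Definition renaming_comp (V : Type) (gen : V -> V -> Type) (ρ ρ' : renaming gen) :
  renaming gen := Renaming (fun x y s => renl ρ (renl ρ' s)).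
Definition renaming_id (V : Type) (gen : V -> V -> Type) : renaming gen :=
  Renaming (ren := id) (fun x y s => s).

(** The formal tricategory and its formal 3-trace are a target for evaluation
   like any other; letters go to renamed letters. *)
Notation formTr := (formTri (@form2_eq _ _)).
Notation formTrQ := (formTrace (@form2_eq _ _) (@tform2_eq _ _)).
Notation rword ρ b := (evw (T := formTr) (o := ren ρ)
  (fun _ _ g => w_gen (renl ρ g)) b).
Notation rform1 ρ s := (ev1 (T := formTr) (o := ren ρ)
  (fun _ _ g => w_gen (renl ρ g)) s).
Notation rform2 ρ α := (ev2 (T := formTr) (o := ren ρ)
  (fun _ _ g => w_gen (renl ρ g)) α).
Notation rloop ρ v := (evl formTrQ (o := ren ρ)
  (fun _ _ g => w_gen (renl ρ g)) v).
Notation rtform1 ρ s := (evt1 formTrQ (o := ren ρ)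
  (fun _ _ g => w_gen (renl ρ g)) s).
Notation rtform2 ρ α := (evt2 formTrQ (o := ren ρ)
  (fun _ _ g => w_gen (renl ρ g)) α).

(** Cells over propositionally equal words cannot be rewritten, since their
   types mention the words.  Instead the values of words and cells are
   generalized, starting with the cells of highest dimension, and the resulting
   variables substituted. *)
Ltac subst_values := repeat match goal with
  | |- _ = _ -> _ => let h := fresh in intro h; subst
  | |- JMeq _ _ -> _ => let h := fresh in intro h; apply JMeq_eq in h; subst
  | |- forall _ : _, _ => intro
   end; subst; try exact: JMeq_refl.

(** * Evaluation of renamed words and cells *)

Section Relabelling.
Context {V : Type} {gen : V -> V -> Type}.

Variable ρ : renaming gen.
Notation σ := (ren ρ).

Lemma wlen_rename (x y : V) (b : word gen x y) : wlen (rword ρ b) = wlen b.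
Proof. by elim: x y / b => //= x y z b -> c ->. Qed.

Fixpoint rename_subcell (x y : V) (b c : word gen x y) (s : subcell b c) :
  subcell (rword ρ b) (rword ρ c) :=
  match s in subcell b c return subcell (rword ρ b) (rword ρ c) with
  | s_a _ _ _ _ b c d => s_a (rword ρ b) (rword ρ c) (rword ρ d)
  | s_aV _ _ _ _ b c d => s_aV (rword ρ b) (rword ρ c) (rword ρ d)
  | s_l _ _ b => s_l (rword ρ b)
  | s_lV _ _ b => s_lV (rword ρ b)
  | s_r _ _ b => s_r (rword ρ b)
  | s_rV _ _ b => s_rV (rword ρ b)
  | s_left _ _ _ _ _ c s => s_left (rword ρ c) (rename_subcell s)
  | s_right _ _ _ b _ _ s => s_right (rword ρ b) (rename_subcell s)
  end.

Definition rename_cell (v w : loop gen) (s : cell v w) : cell (rloop ρ v) (rloop ρ w) :=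
  match s in cell v w return cell (rloop ρ v) (rloop ρ w) with
  | cell_sub _ _ _ s => cell_sub (rename_subcell s)
  | cell_phi _ _ b c => cell_phi (rword ρ b) (rword ρ c)
  end.

Lemma subcell1_rename (x y : V) (b c : word gen x y) (s : subcell b c) :
  subcell1 (rename_subcell s) = rform1 ρ (subcell1 s).
Proof. by elim: x y b c / s => //= x y z b b' c s ->. Qed.

Lemma cell1_rename (v w : loop gen) (s : cell v w) :
  cell1 (rename_cell s) = rtform1 ρ (cell1 s).
Proof. by case: v w / s => //= x b c s; rewrite subcell1_rename. Qed.

Context {T : TriData} {B : BicatData} (P : TraceData T B).
Variable o : V -> T.
Variable e : forall x y : V, gen x y -> Hom (o x) (o y).
Notation e' := (fun (x y : V) (s : gen x y) => e (renl ρ s)).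

Lemma evw_rename (x y : V) (b : word gen x y) :
  evw e (rword ρ b) = evw (o := fun x => o (σ x)) e' b.
Proof.
elim: x y / b => //= x y z b hb c hc.
by rewrite -hb -hc.
Qed.

Ltac gen_words := repeat match goal with
  | |- context [evw e ?t] => match t with evw _ ?s =>
      is_var s; generalize (evw_rename s); generalize (evw e t) end end.
Ltac gen_form1_ih := repeat match goal with
  | h : JMeq (ev1 e ?t) _ |- _ => revert h; generalize (ev1 e t) end.

Lemma ev1_rename (x y : V) (b c : word gen x y) (s : form1 b c) :
  JMeq (ev1 e (rform1 ρ s)) (ev1 (o := fun x => o (σ x)) e' s).
Proof.
elim: x y b c / s => /= *; gen_form1_ih; gen_words; subst_values.
Qed.

Ltac gen_form2_ih := repeat match goal with
  | h : JMeq (ev2 e ?t) _ |- _ => revert h; generalize (ev2 e t) end.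
Ltac gen_form1 := repeat match goal with
  | |- context [ev1 e ?t] => match t with ev1 _ ?s =>
      is_var s; generalize (ev1_rename s); generalize (ev1 e t) end end.

Lemma ev2_rename (x y : V) (b c : word gen x y) (s t : form1 b c) (α : form2 s t) :
  JMeq (ev2 e (rform2 ρ α)) (ev2 (o := fun x => o (σ x)) e' α).
Proof.
elim: x y b c s t / α => /= *; gen_form2_ih; gen_form1; gen_words; subst_values.
Qed.

Lemma evl_rename v : evl P e (rloop ρ v) = evl P (o := fun x => o (σ x)) e' v.
Proof. by rewrite /evl -evw_rename. Qed.

Ltac gen_loops := repeat match goal with
  | |- context [evl P e ?t] => match t with evl _ _ ?s =>
      is_var s; generalize (evl_rename s); generalize (evl P e t) end end.
Ltac gen_tform1_ih := repeat match goal with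
  | h : JMeq (evt1 P e ?t) _ |- _ => revert h; generalize (evt1 P e t) end.

Lemma evt1_rename (v w : loop gen) (s : tform1 v w) :
  JMeq (evt1 P e (rtform1 ρ s)) (evt1 P (o := fun x => o (σ x)) e' s).
Proof.
elim: v w / s => /= *; gen_tform1_ih; gen_loops; rewrite /evl /tr1 /phi_ /=;
  gen_form1; gen_words; subst_values.
Qed.

Ltac gen_tform1 := repeat match goal with
  | |- context [evt1 P e ?t] => match t with evt1 _ _ ?s =>
      is_var s; generalize (evt1_rename s); generalize (evt1 P e t) end end.
Ltac gen_tform2_ih := repeat match goal with
  | h : JMeq (evt2 P e ?t) _ |- _ => revert h; generalize (evt2 P e t) end.
Ltac gen_form2 := repeat match goal with
  | |- context [ev2 e ?t] => match t with ev2 _ ?s =>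
      is_var s; generalize (ev2_rename s); generalize (ev2 e t) end end.

Lemma evt2_rename (v w : loop gen) (s t : tform1 v w) (α : tform2 s t) :
  JMeq (evt2 P e (rtform2 ρ α)) (evt2 P (o := fun x => o (σ x)) e' α).
Proof.
elim: v w s t / α => /= *; gen_tform2_ih; gen_tform1; gen_loops;
  rewrite /evl /tr1 /phi_ /=; gen_form2; gen_form1; gen_words; subst_values.
Qed.
End Relabelling.

(** * Functoriality of renaming *)

Section Functoriality.
Context {V : Type} {gen : V -> V -> Type}.

(** The case of [evw_rename] in which the target of the evaluation is itself the formal
    tricategory. *)
Lemma rename_word_comp (ρ ρ' : renaming gen) (x y : V) (b : word gen x y) :
  rword ρ (rword ρ' b) = rword (renaming_comp ρ ρ') b.
Proof. exact: (evw_rename ρ' (T := formTr)). Qed.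

Lemma rename_word_id (x y : V) (b : word gen x y) : rword (renaming_id gen) b = b.
Proof. by elim: x y / b => //= x y z b hb c hc; rewrite /box0 /= hb hc. Qed.

Lemma rename_loop_comp (ρ ρ' : renaming gen) (v : loop gen) :
  rloop ρ (rloop ρ' v) = rloop (renaming_comp ρ ρ') v.
Proof. exact: (evl_rename ρ' formTrQ). Qed.

Lemma rename_loop_id (v : loop gen) : rloop (renaming_id gen) v = v.
Proof. case: v => x b; by rewrite /evl /= rename_word_id. Qed.

Ltac gen_subcell_ih := repeat match goal with
  | h : JMeq ?t _ |- _ => revert h; generalize t end.

Lemma rename_subcell_comp (ρ ρ' : renaming gen) (x y : V) (b c : word gen x y)
    (s : subcell b c) :
  JMeq (rename_subcell ρ (rename_subcell ρ' s))
    (rename_subcell (renaming_comp ρ ρ') s).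
Proof.
elim: x y b c / s => /= *; gen_subcell_ih; rewrite !rename_word_comp;
  subst_values.
Qed.

Lemma rename_subcell_id (x y : V) (b c : word gen x y) (s : subcell b c) :
  JMeq (rename_subcell (renaming_id gen) s) s.
Proof.
elim: x y b c / s => /= *; gen_subcell_ih; rewrite !rename_word_id; subst_values.
Qed.

Lemma rename_cell_comp (ρ ρ' : renaming gen) (v w : loop gen) (s : cell v w) :
  JMeq (rename_cell ρ (rename_cell ρ' s)) (rename_cell (renaming_comp ρ ρ') s).
Proof.
case: v w / s => [x b c s|x y b c] /=.
  have := rename_subcell_comp ρ ρ' s; move: (rename_subcell ρ _).
  rewrite /evl /= !rename_word_comp; subst_values.
rewrite /evl /= !rename_word_comp; subst_values.
Qed.

Lemma rename_cell_id (v w : loop gen) (s : cell v w) :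
  JMeq (rename_cell (renaming_id gen) s) s.
Proof.
case: v w / s => [x b c s|x y b c] /=.
  have := rename_subcell_id s; move: (rename_subcell _ _).
  rewrite /evl /= !rename_word_id; subst_values.
rewrite /evl /= !rename_word_id; subst_values.
Qed.
End Functoriality.

(** * Renaming in the bicategory of formal traces *)

Lemma ccons_JMeq (V : Type) (D : V -> V -> Type) (x y z x' y' z' : V)
    (f : D x y) (f' : D x' y') (p : chain D y z) (p' : chain D y' z') :
  x = x' -> y = y' -> z = z' -> JMeq f f' -> JMeq p p' ->
  JMeq (ccons f p) (ccons f' p').
Proof.
move=> ex ey ez; subst x' y' z' => hf hp.
by rewrite (JMeq_eq hf) (JMeq_eq hp).
Qed.

(** The right-hand sides have the shape of the recursive clause of [strval_appV]. With all strings
    replaced by variables, their equalities can be substituted. *)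
Lemma appV_step_JMeq (C : BicatData) (u v w x : C) (d d' : hom1 u v) (p p' : hom1 v w)
    (q q' : hom1 w x) (pq pq' : hom1 v x) (dp dp' : hom1 u w) (dpq dpq' : hom1 u x)
    (A : hom2 (pq ∘ d) dpq) (A' : hom2 (pq' ∘ d') dpq')
    (I : hom2 (q ∘ p) pq) (I' : hom2 (q' ∘ p') pq')
    (K : hom2 dp (p ∘ d)) (K' : hom2 dp' (p' ∘ d')) :
  d = d' -> p = p' -> q = q' -> pq = pq' -> dp = dp' -> dpq = dpq' ->
  JMeq A A' -> JMeq I I' -> JMeq K K' ->
  JMeq (A • (I ∗ id2 d) • ascV q p d • (id2 q ∗ K))
    (A' • (I' ∗ id2 d') • ascV q' p' d' • (id2 q' ∗ K')).
Proof.
move=> *; subst d' p' q' pq' dp' dpq'.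
by do 3 match goal with h : JMeq _ _ |- _ => rewrite (JMeq_eq h) {h} end.
Qed.

(** This is the shape of the composition constraint of [evalX]: the constraint of [evF] is an
    identity. *)
Lemma vcomp_id2_JMeq (C : BicatData) (x y z x' y' z' : C) (g : hom1 y z) (f : hom1 x y)
    (k : hom1 x z) (g' : hom1 y' z') (f' : hom1 x' y') (k' : hom1 x' z')
    (α : hom2 (g ∘ f) k) (α' : hom2 (g' ∘ f') k') :
  x = x' -> y = y' -> z = z' -> JMeq g g' -> JMeq f f' -> JMeq k k' ->
  JMeq α α' -> JMeq (α • id2 (g ∘ f)) (α' • id2 (g' ∘ f')).
Proof.
move=> ex ey ez; subst x' y' z'.
move=> eg ef ek; have eg' := JMeq_eq eg; have ef' := JMeq_eq ef.
have ek' := JMeq_eq ek; subst g' f' k' => h; rewrite (JMeq_eq h); exact: JMeq_refl.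
Qed.

Section Reindexing.
Context {n : nat}.
Notation gen := (@letter n).

Lemma vertex_eq (v w : vertex n) : vloop v = vloop w -> v = w.
Proof.
case: v => v hv; case: w => w hw /= e; subst w.
by rewrite (eq_irrelevance hv hw).
Qed.

Section Renaming.
Variable ρ : renaming gen.

Definition rename_vertex (v : vertex n) : vertex n :=
  Vertex (vloop := rloop ρ (vloop v)) (etrans (wlen_rename ρ (lword v)) (vlen v)).

Definition reindex : RMap (bicatX n) (bicatX n) :=
  @MkRMap (bicatX n) (bicatX n) rename_vertex
    (fun v w p =>
       cmap (i := rename_vertex) (fun v w (s : cell v w) => rename_cell ρ s) p).

Notation val p := (strval (C := formBQ) (i := @vloop n)
  (fun v w (s : cell v w) => cell1 s) p).

Notation cells p := (cmap (D := @tform1 _ gen) (i := @vloop n)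
  (fun v w (s : cell v w) => cell1 s) p).

Lemma strval_reindex (v w : bicatX n) (p : hom1 v w) :
  val (r1 reindex p) = rtform1 ρ (val p) :> tform1 _ _.
Proof.
(* A nonempty string is treated together with its first cell, because [cev] evaluates it through
   [cevc]. *)
rewrite /strval; case: v w / p => //= u v w s p.
elim: v w / p u s => [v|v w x t p IH] u s /=; first by rewrite cell1_rename.
by rewrite IH cell1_rename.
Qed.

Lemma reindex_comp (u v w : bicatX n) (p : hom1 u v) (q : hom1 v w) :
  r1 reindex (q ∘ p) = r1 reindex q ∘ r1 reindex p.
Proof. by elim: u v / p q => //= u v x s p IH q; rewrite -IH. Qed.

Lemma cev_consV_reindex (u v w : bicatX n) (s : cell u v) (p : hom1 v w) :
  JMeq (cev_consV (B := formBQ) (cell1 (rename_cell ρ s))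
         (cells (r1 reindex p)))
    (rtform2 ρ (cev_consV (B := formBQ) (cell1 s)
         (cells p))).
Proof.
case: v w / p s => [v|v w x t p] s /=; first by rewrite cell1_rename.
have := strval_reindex (ccons t p).
rewrite /strval /= !cell1_rename => ->; rewrite ?cell1_rename; exact: JMeq_refl.
Qed.

Lemma cev_cons_reindex (u v w : bicatX n) (s : cell u v) (p : hom1 v w) :
  JMeq (cev_cons (B := formBQ) (cell1 (rename_cell ρ s))
         (cells (r1 reindex p)))
    (rtform2 ρ (cev_cons (B := formBQ) (cell1 s)
         (cells p))).
Proof.
case: v w / p s => [v|v w x t p] s /=; first by rewrite cell1_rename.
have := strval_reindex (ccons t p).
rewrite /strval /= !cell1_rename => ->; rewrite ?cell1_rename; exact: JMeq_refl.
Qed.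

Lemma strval_appV_reindex (u v w : bicatX n) (p : hom1 u v) (q : hom1 v w) :
  JMeq (strval_appV (C := formBQ) (i := @vloop n)
         (fun v w (s : cell v w) => cell1 s) (r1 reindex p) (r1 reindex q))
    (rtform2 ρ (strval_appV (C := formBQ) (i := @vloop n)
         (fun v w (s : cell v w) => cell1 s) p q)).
Proof.
elim: u v / p q => [u|u v x s p IH] q /=.
  by rewrite strval_reindex.
apply: (@appV_step_JMeq (@formBQ _ gen)).
- exact: cell1_rename.
- exact: strval_reindex.
- exact: strval_reindex.
- by have := strval_reindex (q ∘ p); rewrite reindex_comp.
- exact: (strval_reindex (ccons s p)).
- by have := strval_reindex (q ∘ ccons s p); rewrite reindex_comp.
- by have := cev_consV_reindex s (q ∘ p); rewrite reindex_comp.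
- exact: IH.
- exact: (cev_cons_reindex s p).
Qed.

Section Eval.
Context {T : TriData} {B : Bicat} (P : TraceData T B).

Definition evalX (o : 'I_n -> T) (e : forall x y, gen x y -> Hom (o x) (o y)) :
  PFunData (bicatX n) B := compF (evF P e) (strF (C := formBQ) _ _).

Variable o : 'I_n -> T.
Variable e : forall x y, gen x y -> Hom (o x) (o y).

Lemma evt2_JMeq (v w : loop gen) (s s' t t' : tform1 v w) (α : tform2 s t)
  (β : tform2 s' t') : s = s' -> t = t' -> JMeq α β ->
  JMeq (evt2 P e α) (evt2 P e β).
Proof. by move=> es et h; subst s' t'; rewrite (JMeq_eq h). Qed.

Notation e' := (fun (x y : 'I_n) (s : gen x y) => e (renl ρ s)).

Lemma evt1_reindex (v w : bicatX n) (p : hom1 v w) :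
  JMeq (evt1 P e (val (r1 reindex p)))
    (evt1 P (o := fun x => o (ren ρ x)) e' (val p)).
Proof. rewrite strval_reindex; exact: evt1_rename. Qed.

(** Reindexing a string renames its value in the formal bicategory, and evaluating a renamed cell is
    evaluating the cell with [e']. *)
Lemma reindex_pullback :
  strict_pullback reindex (evalX e) (evalX (o := fun x => o (ren ρ x)) e').
Proof.
split=> //.
- move=> x y z g f; exact: reindex_comp.
- apply: rmap_eq => [v|v w p]; first exact: evl_rename.
  exact: evt1_reindex.
- move=> v w p q α.
  (* The renaming of [α] has the right end points only after transport along [strval_reindex]. *)
  have [α' hα] : exists α' : tform2 (val (r1 reindex p)) (val (r1 reindex q)),
      JMeq α' (rtform2 ρ α).
    by rewrite !strval_reindex; exists (rtform2 ρ α).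
  exists α'; apply: JMeq_trans (evt2_JMeq _ _ hα) (evt2_rename _ _ _ _).
    exact: strval_reindex.
  exact: strval_reindex.
- move=> u v w q p.
  have h1 := strval_appV_reindex p q.
  apply: vcomp_id2_JMeq; try exact: evl_rename; try exact: evt1_reindex.
    by have := evt1_reindex (q ∘ p); rewrite reindex_comp.
  apply: JMeq_trans (evt2_JMeq _ _ h1) (evt2_rename ρ P e _).
    by rewrite !strval_reindex.
  by have := strval_reindex (q ∘ p); rewrite reindex_comp.
- move=> v; rewrite /= evl_rename; exact: JMeq_refl.
Qed.
End Eval.
End Renaming.

Lemma reindex_comp_renaming (ρ ρ' : renaming gen) :
  rcomp (reindex ρ) (reindex ρ') = reindex (renaming_comp ρ ρ').
Proof.
have e0 (v : vertex n) :
  rename_vertex ρ (rename_vertex ρ' v) = rename_vertex (renaming_comp ρ ρ') v.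
  apply: vertex_eq; exact: rename_loop_comp.
apply: rmap_eq => [v|v w p]; first exact: e0.
rewrite /=; elim: v w / p => [v|u v w s p IH] /=; first by rewrite e0.
by apply: ccons_JMeq => //; apply: rename_cell_comp.
Qed.

Lemma reindex_id_renaming : reindex (renaming_id gen) = idF.
Proof.
have e0 (v : vertex n) : rename_vertex (renaming_id gen) v = v.
  apply: vertex_eq; exact: rename_loop_id.
apply: rmap_eq => [v|v w p]; first exact: e0.
rewrite /=; elim: v w / p => [v|u v w s p IH] /=; first by rewrite e0.
by apply: ccons_JMeq => //; apply: rename_cell_id.
Qed.
End Reindexing.

(** * Cyclic rotation of the letters *)

Section Rotation.
Context {n : nat}.

Definition rotation : renaming (@letter n) :=
  Renaming (ren := @ordS n) (fun x y (s : letter x y) =>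
    match s in letter x y return letter (ordS x) (ordS y) with
    | Letter i => Letter (ordS i)
    end).

Lemma ordS_ord_pred (i : 'I_n) : ordS (ord_pred i) = ord_pred (ordS i).
Proof. by rewrite ordSK ord_predK. Qed.

(** The letter starting at [ord_pred i] ends at [ordS (ord_pred i)], which equals the required
    [ord_pred (ordS i)] only propositionally; hence the transport. *)
Definition rotation_inv : renaming (@letter n) :=
  Renaming (ren := @ord_pred n) (fun x y (s : letter x y) =>
    match s in letter x y return letter (ord_pred x) (ord_pred y) with
    | Letter i => eq_rect _ (letter (ord_pred i)) (Letter (ord_pred i)) _
                    (ordS_ord_pred i)
    end).

(** Exactly one letter starts at each index, so the source determines the letter. This disposes of
    the transport in [rotation_inv]. *)
Lemma letter_JMeq (i j i' j' : 'I_n) (s : letter i j) (t : letter i' j') :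
  i = i' -> JMeq s t.
Proof.
case: s => {}i; case: t => {}i' e; subst i'; exact: JMeq_refl.
Qed.

Lemma rotation_comp_inv : renaming_comp rotation_inv rotation = renaming_id (@letter n).
Proof.
apply: renaming_eq => [i|i j s]; first exact: ordSK.
apply: letter_JMeq; exact: ordSK.
Qed.

Lemma rotation_inv_comp : renaming_comp rotation rotation_inv = renaming_id (@letter n).
Proof.
apply: renaming_eq => [i|i j s]; first exact: ord_predK.
apply: letter_JMeq; exact: ord_predK.
Qed.
End Rotation.

Lemma is_2limit_rot1 (T : TriData) (B : Bicat) (P : TraceData T B) (n : nat)
    (f : cstring T n) (L : B) :
  is_2limit (evalE P f) L <-> is_2limit (evalE P (rot1 f)) L.
Proof.
(* Both diagrams are evaluations of renamed letters on the same string [f], for the identity and for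
   [rotation]. *)
pose J (ρ : renaming (@letter n)) : PFunData (bicatX n) B :=
  evalX P (o := fun x => cob f (ren ρ x)) (fun x y s => cletter f (renl ρ s)).
have e1 : evalE P (rot1 f) = J rotation.
  rewrite /J /evalE /evalX; congr (compF (evF P _) _).
  apply: functional_extensionality_dep => i; apply: functional_extensionality_dep => j.
  by apply: functional_extensionality_dep; case.
have H1 : strict_pullback (reindex rotation) (J (renaming_id _)) (J rotation) :=
  reindex_pullback rotation P (cletter f).
have H2 : strict_pullback (reindex rotation_inv) (J rotation) (J (renaming_id _)).
  (* The identity is written as [rotation] after [rotation_inv], so the original diagram becomes a
     renaming of the rotated one. *)
  rewrite -rotation_inv_comp.
  exact: (reindex_pullback rotation_inv P (fun x y s => cletter f (renl rotation s))).
have k1 : rcomp (reindex (n := n) rotation) (reindex rotation_inv) = idF.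
  by rewrite reindex_comp_renaming rotation_inv_comp reindex_id_renaming.
have k2 : rcomp (reindex (n := n) rotation_inv) (reindex rotation) = idF.
  by rewrite reindex_comp_renaming rotation_comp_inv reindex_id_renaming.
have e0 : evalE P f = J (renaming_id _) by [].
rewrite e0 e1; split.
  exact: is_2limit_pullback H1 H2 k1 k2.
exact: is_2limit_pullback H2 H1 k2 k1.
Qed.

Theorem theorem5p6 (T : Tricat) (B : Bicat) (tr : Trace3 T B)
    (n : nat) (n_gt0 : (0 < n)%N) (f : cstring T n) (k : nat) :
  (forall L : B,
     is_2limit (evalE tr f) L <-> is_2limit (evalE tr (shift k f)) L) /\
  (forall L L' : B,
     is_2limit (evalE tr f) L -> is_2limit (evalE tr (shift k f)) L' ->
     equivalent L L').
Proof.
have h L : is_2limit (evalE tr f) L <-> is_2limit (evalE tr (shift k f)) L.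
  (* The shift by [k.+1] is one rotation of the shift by [k]. *)
  elim: k => // k IH; rewrite IH; exact: is_2limit_rot1.
(* By the first part, [L'] is also a 2-limit of the unshifted diagram, where uniqueness applies. *)
split=> // L L' hL /h; exact: is_2limit_unique.
Qed.
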